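(* Let $\Bbbk$ be an algebraically closed field of characteristic $0$, let $G$ be a finitely generated group and let $M$ be a Yetter-Drinfeld module over $\Bbbk G$ such that $\operatorname{supp}M$ is an infinite conjugacy class of $G$. Then $$\operatorname{GK-dim}\big(\mathscr{B}(M)\#\Bbbk G\big)=\infty .$$
   Context: A Yetter-Drinfeld module over $\Bbbk G$ is a $G$-graded vector space $M=\bigoplus_{g\in G}M_g$ with a linear action of $G$ such that $h\cdot M_g=M_{hgh^{-1}}$ for all $g,h\in G$. Its support is $\operatorname{supp}M=\{g\in G: M_g\neq 0\}$. It is a braided vector space with braiding $c(u\otimes v)=g\cdot v\otimes u$ for $u\in M_g$, $v\in M$. The Nichols algebra is $\mathscr{B}(M)=T(M)/\mathcal{J}(M)$, where $\mathcal{J}(M)=\bigoplus_{n\ge 2}\ker \mathfrak{S}_n$ and $\mathfrak{S}_n=\sum_{\sigma\in\mathbb{S}_n}c_\sigma$ is the quantum symmetrizer on $M^{\otimes n}$ ($c_\sigma$ being obtained from a reduced expression of $\sigma$ by replacing each simple transposition $(i\ i{+}1)$ by $c$ acting in positions $i,i+1$). The bosonization $\mathscr{B}(M)\#\Bbbk G$ is the biproduct Hopf algebra; as an algebra it is the smash product $\mathscr{B}(M)\otimes\Bbbk G$ with $(a\#g)(b\#h)=a(g\cdot b)\#gh$. $\operatorname{GK-dim}$ denotes the Gelfand-Kirillov dimension of an algebra. *)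

(* Defs.v *)
From HB Require Import structures.
From mathcomp Require Import all_boot all_order all_algebra all_fingroup.
From mathcomp Require Import generic_quotient zify.
From mathcomp Require Import boolp classical_sets functions cardinality fsbigop.
From mathcomp Require Import reals ereal normedtype sequences exp.

Set Implicit Arguments.
Unset Strict Implicit.
Unset Printing Implicit Defensive.

Import Order.TTheory GRing.Theory Num.Theory.

Local Open Scope classical_set_scope.
Local Open Scope quotient_scope.
Local Open Scope ring_scope.

Definition fin_supp (I : Type) (V : zmodType) (f : I -> V) : Prop :=
  finite_set [set i | f i != 0].

Lemma fin_suppP (I : choiceType) (V : zmodType) (f : I -> V) :
  fin_supp f <-> exists2 s : seq I, uniq s & forall i, i \notin s -> f i = 0.
Proof.
split=> [/finite_seqP[s fs]|[s us s0]].
  exists (undup s); first exact: undup_uniq.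
  move=> i; rewrite mem_undup => si; apply/eqP/negPn/negP => fi.
  have : [set` s] i by rewrite -fs.
  by move=> /= is_; rewrite is_ in si.
apply: (@sub_finite_set _ _ [set` s]); last exact: finite_seq.
by move=> i /= fi; apply: contraR fi => /s0 ->.
Qed.

Lemma fsumE (I : choiceType) (V : zmodType) (s : seq I) (f : I -> V) : uniq s -> (forall i, i \notin s -> f i = 0) ->
  \sum_(i \in [set: I]) f i = \sum_(i <- s) f i.
Proof.
move=> us s0; rewrite (fsbigE s)//; last by move=> i _; exact: s0.
by apply: eq_bigl => i; exact: mem_set.
Qed.

Section FinSupp.
Context {I : choiceType} {V : zmodType}.
Implicit Types f g : I -> V.

Lemma fin_supp2 (W : zmodType) f (g : I -> W) : fin_supp f -> fin_supp g ->
  exists s : seq I, [/\ uniq s, forall i, i \notin s -> f i = 0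
                              & forall i, i \notin s -> g i = 0].
Proof.
move=> /fin_suppP[s us s0] /fin_suppP[t ut t0]; exists (undup (s ++ t)).
split; [exact: undup_uniq| |] => i; rewrite mem_undup mem_cat negb_or.
  by case/andP => /s0.
by case/andP => _ /t0.
Qed.

Lemma fsumD f g : fin_supp f -> fin_supp g ->
  \sum_(i \in [set: I]) (f i + g i)
  = \sum_(i \in [set: I]) f i + \sum_(i \in [set: I]) g i.
Proof.
move=> ff fg; have [s [us s0 t0]] := fin_supp2 ff fg.
rewrite (fsumE us s0) (fsumE us t0) -big_split.
by rewrite (fsumE us (f := fun i => f i + g i))// => i si; rewrite s0 ?t0 ?addr0.
Qed.

Lemma fsum_map (W : zmodType) (h : V -> W) f :
  h 0 = 0 -> {morph h : x y / x + y} -> fin_supp f ->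
  h (\sum_(i \in [set: I]) f i) = \sum_(i \in [set: I]) h (f i).
Proof.
move=> h0 hD /fin_suppP[s us s0]; rewrite (fsumE us s0) (big_morph h hD h0).
by apply/esym/fsumE => // i /s0 ->.
Qed.

Lemma fin_supp_sub (W : zmodType) f (g : I -> W) : fin_supp f ->
  (forall i, f i = 0 -> g i = 0) -> fin_supp g.
Proof.
move=> /fin_suppP[s us s0] h; apply/fin_suppP; exists s => // i /s0.
exact: h.
Qed.

Lemma fin_suppD f g : fin_supp f -> fin_supp g -> fin_supp (fun i => f i + g i).
Proof.
move=> ff fg; have [s [us s0 t0]] := fin_supp2 ff fg.
by apply/fin_suppP; exists s => // i si; rewrite s0 ?t0 ?addr0.
Qed.

Lemma fsum1 f i0 : (forall i, i != i0 -> f i = 0) ->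
  \sum_(i \in [set: I]) f i = f i0.
Proof.
move=> h; rewrite (fsumE (s := [:: i0])) ?big_seq1//.
by move=> i; rewrite inE => /h.
Qed.

End FinSupp.

Lemma fin_supp_reindex (I J : choiceType) (V : zmodType) (f : I -> V)
    (h : J -> I) (h' : I -> J) : cancel h h' -> cancel h' h ->
  fin_supp f -> fin_supp (f \o h).
Proof.
move=> hK h'K /fin_suppP[s us s0]; apply/fin_suppP; exists (map h' s).
  by rewrite map_inj_uniq//; exact: can_inj h'K.
move=> j jn; apply: s0; apply: contra jn => hj.
by rewrite -(hK j) map_f.
Qed.

(* A set with operations satisfying the axioms of a k-algebra up to a
   congruence; [quotAlg] is the k-algebra of congruence classes. *)
Record algPres (k : fieldType) := AlgPres {
  ap_car : choiceType;
  ap_rel : ap_car -> ap_car -> Prop;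
  ap_zero : ap_car;
  ap_one : ap_car;
  ap_opp : ap_car -> ap_car;
  ap_add : ap_car -> ap_car -> ap_car;
  ap_mul : ap_car -> ap_car -> ap_car;
  ap_scale : k -> ap_car -> ap_car;
  ap_refl : forall x, ap_rel x x;
  ap_sym : forall x y, ap_rel x y -> ap_rel y x;
  ap_trans : forall y x z, ap_rel x y -> ap_rel y z -> ap_rel x z;
  ap_opp_compat : forall x y, ap_rel x y -> ap_rel (ap_opp x) (ap_opp y);
  ap_add_compat : forall x x' y y', ap_rel x x' -> ap_rel y y' ->
    ap_rel (ap_add x y) (ap_add x' y');
  ap_mul_compat : forall x x' y y', ap_rel x x' -> ap_rel y y' ->
    ap_rel (ap_mul x y) (ap_mul x' y');
  ap_scale_compat : forall a x y, ap_rel x y ->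
    ap_rel (ap_scale a x) (ap_scale a y);
  ap_addA : forall x y z,
    ap_rel (ap_add x (ap_add y z)) (ap_add (ap_add x y) z);
  ap_addC : forall x y, ap_rel (ap_add x y) (ap_add y x);
  ap_add0 : forall x, ap_rel (ap_add ap_zero x) x;
  ap_addN : forall x, ap_rel (ap_add (ap_opp x) x) ap_zero;
  ap_mulA : forall x y z,
    ap_rel (ap_mul x (ap_mul y z)) (ap_mul (ap_mul x y) z);
  ap_mul1l : forall x, ap_rel (ap_mul ap_one x) x;
  ap_mul1r : forall x, ap_rel (ap_mul x ap_one) x;
  ap_mulDl : forall x y z,
    ap_rel (ap_mul (ap_add x y) z) (ap_add (ap_mul x z) (ap_mul y z));
  ap_mulDr : forall x y z,
    ap_rel (ap_mul x (ap_add y z)) (ap_add (ap_mul x y) (ap_mul x z));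
  ap_scaleA : forall a b x,
    ap_rel (ap_scale a (ap_scale b x)) (ap_scale (a * b) x);
  ap_scale1 : forall x, ap_rel (ap_scale 1 x) x;
  ap_scaleDr : forall a x y,
    ap_rel (ap_scale a (ap_add x y)) (ap_add (ap_scale a x) (ap_scale a y));
  ap_scaleDl : forall x a b,
    ap_rel (ap_scale (a + b) x) (ap_add (ap_scale a x) (ap_scale b x));
  ap_scaleAl : forall a x y,
    ap_rel (ap_scale a (ap_mul x y)) (ap_mul (ap_scale a x) y);
  ap_scaleAr : forall a x y,
    ap_rel (ap_scale a (ap_mul x y)) (ap_mul x (ap_scale a y));
  ap_nontrivial : ~ ap_rel ap_one ap_zero;
}.

Section QuotAlg.
Context (k : fieldType) (P : algPres k).

Definition ap_equiv (x y : ap_car P) : bool := `[< ap_rel x y >].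

Lemma ap_equiv_class : equiv_class_of ap_equiv.
Proof.
split=> [x|x y|y x z]; first by apply/asboolP; exact: ap_refl.
  by apply/asboolP/asboolP; exact: ap_sym.
by move=> /asboolP xy /asboolP yz; apply/asboolP; exact: ap_trans xy yz.
Qed.

Canonical ap_equiv_rel := EquivRelPack ap_equiv_class.
Canonical ap_encModRel := defaultEncModRel ap_equiv.

Definition quotAlg := {eq_quot ap_equiv}.
HB.instance Definition _ := Choice.on quotAlg.

Definition qpi (x : ap_car P) : quotAlg := \pi_(quotAlg) x.
Definition qrepr (x : quotAlg) : ap_car P := repr x.

Lemma qreprK : cancel qrepr qpi. Proof. exact: reprK. Qed.

Lemma qpiP x y : qpi x = qpi y <-> ap_rel x y.
Proof.
split=> [/eqmodP/asboolP//|xy].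
by apply/eqmodP/asboolP.
Qed.

Lemma qrepr_pi x : ap_rel (qrepr (qpi x)) x.
Proof. by apply/qpiP; rewrite qreprK. Qed.

Definition qadd x y := qpi (ap_add (qrepr x) (qrepr y)).
Definition qmul x y := qpi (ap_mul (qrepr x) (qrepr y)).
Definition qopp x := qpi (ap_opp (qrepr x)).
Definition qscale (a : k) x := qpi (ap_scale a (qrepr x)).

Lemma qaddE x y : qadd (qpi x) (qpi y) = qpi (ap_add x y).
Proof. by apply/qpiP; apply: ap_add_compat; exact: qrepr_pi. Qed.
Lemma qmulE x y : qmul (qpi x) (qpi y) = qpi (ap_mul x y).
Proof. by apply/qpiP; apply: ap_mul_compat; exact: qrepr_pi. Qed.
Lemma qoppE x : qopp (qpi x) = qpi (ap_opp x).
Proof. by apply/qpiP; apply: ap_opp_compat; exact: qrepr_pi. Qed.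
Lemma qscaleE a x : qscale a (qpi x) = qpi (ap_scale a x).
Proof. by apply/qpiP; apply: ap_scale_compat; exact: qrepr_pi. Qed.

Local Definition qE := (qaddE, qmulE, qoppE, qscaleE).

Lemma qaddA : associative qadd.
Proof.
move=> x y z; rewrite -[x]qreprK -[y]qreprK -[z]qreprK !qE.
by apply/qpiP; exact: ap_addA.
Qed.
Lemma qaddC : commutative qadd.
Proof.
move=> x y; rewrite -[x]qreprK -[y]qreprK !qE.
by apply/qpiP; exact: ap_addC.
Qed.
Lemma qadd0 : left_id (qpi (ap_zero P)) qadd.
Proof. by move=> x; rewrite -[x]qreprK !qE; apply/qpiP; exact: ap_add0. Qed.
Lemma qaddN : left_inverse (qpi (ap_zero P)) qopp qadd.
Proof. by move=> x; rewrite -[x]qreprK !qE; apply/qpiP; exact: ap_addN. Qed.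

HB.instance Definition _ := GRing.isZmodule.Build quotAlg qaddA qaddC qadd0 qaddN.

Lemma qmulA : associative qmul.
Proof.
move=> x y z; rewrite -[x]qreprK -[y]qreprK -[z]qreprK !qE.
by apply/qpiP; exact: ap_mulA.
Qed.
Lemma qmul1l : left_id (qpi (ap_one P)) qmul.
Proof. by move=> x; rewrite -[x]qreprK !qE; apply/qpiP; exact: ap_mul1l. Qed.
Lemma qmul1r : right_id (qpi (ap_one P)) qmul.
Proof. by move=> x; rewrite -[x]qreprK !qE; apply/qpiP; exact: ap_mul1r. Qed.
Lemma qmulDl : left_distributive qmul +%R.
Proof.
move=> x y z; rewrite -[x]qreprK -[y]qreprK -[z]qreprK /+%R /= !qE.
by apply/qpiP; exact: ap_mulDl.
Qed.
Lemma qmulDr : right_distributive qmul +%R.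
Proof.
move=> x y z; rewrite -[x]qreprK -[y]qreprK -[z]qreprK /+%R /= !qE.
by apply/qpiP; exact: ap_mulDr.
Qed.
Lemma q1_neq0 : qpi (ap_one P) != 0.
Proof. by apply/eqP => /qpiP; exact: ap_nontrivial. Qed.

HB.instance Definition _ := GRing.Zmodule_isNzRing.Build quotAlg
  qmulA qmul1l qmul1r qmulDl qmulDr q1_neq0.

Lemma qscaleA a b x : qscale a (qscale b x) = qscale (a * b) x.
Proof. by rewrite -[x]qreprK !qE; apply/qpiP; exact: ap_scaleA. Qed.
Lemma qscale1 : left_id 1 qscale.
Proof. by move=> x; rewrite -[x]qreprK !qE; apply/qpiP; exact: ap_scale1. Qed.
Lemma qscaleDr : right_distributive qscale +%R.
Proof.
move=> a x y; rewrite -[x]qreprK -[y]qreprK /+%R /= !qE.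
by apply/qpiP; exact: ap_scaleDr.
Qed.
Lemma qscaleDl x : {morph qscale^~ x : a b / a + b}.
Proof.
move=> a b; rewrite -[x]qreprK [in RHS]/+%R /= !qE.
by apply/qpiP; exact: ap_scaleDl.
Qed.

HB.instance Definition _ := GRing.Zmodule_isLmodule.Build k quotAlg
  qscaleA qscale1 qscaleDr qscaleDl.

Lemma qscaleAl (a : k) (x y : quotAlg) : a *: (x * y) = (a *: x) * y.
Proof.
rewrite -[x]qreprK -[y]qreprK /*:%R /*%R /= !qE.
by apply/qpiP; exact: ap_scaleAl.
Qed.
HB.instance Definition _ := GRing.Lmodule_isLalgebra.Build k quotAlg qscaleAl.

Lemma qscaleAr (a : k) (x y : quotAlg) : a *: (x * y) = x * (a *: y).
Proof.
rewrite -[x]qreprK -[y]qreprK /*:%R /*%R /= !qE.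
by apply/qpiP; exact: ap_scaleAr.
Qed.
HB.instance Definition _ := GRing.Lalgebra_isAlgebra.Build k quotAlg qscaleAr.

Lemma qpi0 : qpi (ap_zero P) = 0. Proof. by []. Qed.
Lemma qpi1 : qpi (ap_one P) = 1. Proof. by []. Qed.
Lemma qpiN x : qpi (ap_opp x) = - qpi x. Proof. by rewrite -qoppE. Qed.
Lemma qpiD x y : qpi (ap_add x y) = qpi x + qpi y. Proof. by rewrite -qaddE. Qed.
Lemma qpiM x y : qpi (ap_mul x y) = qpi x * qpi y. Proof. by rewrite -qmulE. Qed.
Lemma qpiZ a x : qpi (ap_scale a x) = a *: qpi x. Proof. by rewrite -qscaleE. Qed.

End QuotAlg.

(* The tensor algebra T(M): expressions in letters from M modulo the least
   congruence making them an associative unital k-algebra in which [TVar] is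
   k-linear.  Its universal property is [tlift]/[tlift_prod]/[tens_ext] below. *)
Section TensorAlgebra.
Context (k : fieldType) (M : lmodType k).

Inductive texpr : Type :=
| TVar (m : M) | TZero | TOne | TOpp (s : texpr)
| TAdd (s t : texpr) | TMul (s t : texpr) | TScale (a : k) (s : texpr).

HB.instance Definition _ := gen_eqMixin texpr.
HB.instance Definition _ := gen_choiceMixin texpr.

Inductive teq : texpr -> texpr -> Prop :=
| teq_refl x : teq x x
| teq_sym x y : teq x y -> teq y x
| teq_trans y x z : teq x y -> teq y z -> teq x z
| teq_opp x y : teq x y -> teq (TOpp x) (TOpp y)
| teq_add x x' y y' : teq x x' -> teq y y' -> teq (TAdd x y) (TAdd x' y')
| teq_mul x x' y y' : teq x x' -> teq y y' -> teq (TMul x y) (TMul x' y')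
| teq_scale a x y : teq x y -> teq (TScale a x) (TScale a y)
| teq_addA x y z : teq (TAdd x (TAdd y z)) (TAdd (TAdd x y) z)
| teq_addC x y : teq (TAdd x y) (TAdd y x)
| teq_add0 x : teq (TAdd TZero x) x
| teq_addN x : teq (TAdd (TOpp x) x) TZero
| teq_mulA x y z : teq (TMul x (TMul y z)) (TMul (TMul x y) z)
| teq_mul1l x : teq (TMul TOne x) x
| teq_mul1r x : teq (TMul x TOne) x
| teq_mulDl x y z : teq (TMul (TAdd x y) z) (TAdd (TMul x z) (TMul y z))
| teq_mulDr x y z : teq (TMul x (TAdd y z)) (TAdd (TMul x y) (TMul x z))
| teq_scaleA a b x : teq (TScale a (TScale b x)) (TScale (a * b) x)
| teq_scale1 x : teq (TScale 1 x) x
| teq_scaleDr a x y : teq (TScale a (TAdd x y)) (TAdd (TScale a x) (TScale a y))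
| teq_scaleDl x a b : teq (TScale (a + b) x) (TAdd (TScale a x) (TScale b x))
| teq_scaleAl a x y : teq (TScale a (TMul x y)) (TMul (TScale a x) y)
| teq_scaleAr a x y : teq (TScale a (TMul x y)) (TMul x (TScale a y))
| teq_var a m n : teq (TVar (a *: m + n)) (TAdd (TScale a (TVar m)) (TVar n)).

Definition multilinear (V : lmodType k) (f : seq M -> V) : Prop :=
  forall (a : k) (u v : seq M) (x y : M),
    f (u ++ (a *: x + y) :: v) = a *: f (u ++ x :: v) + f (u ++ y :: v).

Section Lift.
Context (V : lmodType k).

Fixpoint teval (t : texpr) (f : seq M -> V) (w : seq M) : V :=
  match t with
  | TVar m => f (rcons w m)
  | TZero => 0
  | TOne => f w
  | TOpp s => - teval s f w
  | TAdd s t => teval s f w + teval t f w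
  | TMul s t => teval s (teval t f) w
  | TScale a s => a *: teval s f w
  end.

Lemma teval_ml t f : multilinear f -> multilinear (teval t f).
Proof.
elim: t f => [m||| s IH|s IHs t IHt|s IHs t IHt|b s IH] f fl a u v x y //=.
- by rewrite !rcons_cat /= fl.
- by rewrite scaler0 addr0.
- by rewrite IH// opprD scalerN.
- by rewrite IHs// IHt// scalerDr addrACA.
- exact: IHs (IHt _ fl) _ _ _ _ _.
- by rewrite IH// scalerDr !scalerA mulrC.
Qed.

Lemma teval_lin t (a : k) (f g : seq M -> V) w :
  teval t (fun w => a *: f w + g w) w = a *: teval t f w + teval t g w.
Proof.
elim: t f g w => [m||| s IH|s IHs t IHt|s IHs t IHt|b s IH] f g w //=.
- by rewrite scaler0 addr0.
- by rewrite IH opprD scalerN.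
- by rewrite IHs IHt scalerDr addrACA.
- by rewrite -IHs; congr (teval s _ w); apply/funext => z; rewrite IHt.
- by rewrite IH scalerDr !scalerA mulrC.
Qed.

Lemma teval_teq s t : teq s t -> forall f, multilinear f -> teval s f = teval t f.
Proof.
elim=> {s t} /=.
- by [].
- by move=> x y _ IH f fl; rewrite IH.
- by move=> y x z _ IH1 _ IH2 f fl; rewrite IH1// IH2.
- by move=> x y _ IH f fl; rewrite IH.
- by move=> x x' y y' _ IH1 _ IH2 f fl; rewrite IH1// IH2.
- move=> x x' y y' _ IH1 _ IH2 f fl; rewrite IH2// IH1//; exact: teval_ml.
- by move=> a x y _ IH f fl; rewrite IH.
- by move=> x y z f fl; apply/funext => w; rewrite addrA.
- by move=> x y f fl; apply/funext => w; rewrite addrC.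
- by move=> x f fl; apply/funext => w; rewrite add0r.
- by move=> x f fl; apply/funext => w; rewrite addNr.
- by [].
- by [].
- by move=> x f fl; congr teval; apply/funext.
- by [].
- move=> x y z f fl; apply/funext => w.
  rewrite -[X in X + _]scale1r -teval_lin; congr (teval x _ w).
  by apply/funext => v; rewrite scale1r.
- by move=> a b x f fl; apply/funext => w; rewrite scalerA.
- by move=> x f fl; apply/funext => w; rewrite scale1r.
- by move=> a x y f fl; apply/funext => w; rewrite scalerDr.
- by move=> x a b f fl; apply/funext => w; rewrite scalerDl.
- by [].
- move=> a x y f fl; apply/funext => w.
  have /= := teval_lin x a (teval y f) (fun=> 0) w.
  have z0 : teval x (fun=> 0) w = 0.
    have := teval_lin x (-1) (teval y f) (teval y f) w.
    rewrite scaleN1r addNr => h; rewrite -[RHS]h; congr (teval x _ w).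
    by apply/funext => v; rewrite scaleN1r addNr.
  rewrite z0 addr0 => <-; congr (teval x _ w).
  by apply/funext => v; rewrite addr0.
- by move=> a m n f fl; apply/funext => w; rewrite -!cats1 fl.
Qed.

End Lift.

Lemma teq_nontrivial : ~ teq TOne TZero.
Proof.
pose f (w : seq M) : k^o := if w is [::] then 1 else 0.
have fl : multilinear f.
  by move=> a [|z u] v x y /=; rewrite scaler0 addr0.
move=> h; have /(congr1 (@^~ [::])) /= /eqP := teval_teq h fl.
by rewrite oner_eq0.
Qed.

Definition tens_pres : algPres k :=
  @AlgPres k texpr teq TZero TOne TOpp TAdd TMul TScale
    teq_refl teq_sym teq_trans teq_opp teq_add teq_mul teq_scale
    teq_addA teq_addC teq_add0 teq_addN teq_mulA teq_mul1l teq_mul1r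
    teq_mulDl teq_mulDr teq_scaleA teq_scale1 teq_scaleDr teq_scaleDl
    teq_scaleAl teq_scaleAr teq_nontrivial.

Definition tens : algType k := quotAlg tens_pres.

Definition tvar (m : M) : tens := @qpi k tens_pres (TVar m).

Lemma tvar_linear : linear tvar.
Proof.
move=> a m n; rewrite /tvar -(qpiZ (P := tens_pres)) -(qpiD (P := tens_pres)).
by apply/qpiP; exact: teq_var.
Qed.
HB.instance Definition _ := GRing.isLinear.Build k M tens *:%R tvar tvar_linear.

Definition tprod (w : seq M) : tens := \prod_(m <- w) tvar m.

Lemma tprod_nil : tprod [::] = 1. Proof. exact: big_nil. Qed.
Lemma tprod_cons m w : tprod (m :: w) = tvar m * tprod w.
Proof. exact: big_cons. Qed.
Lemma tprod_cat u v : tprod (u ++ v) = tprod u * tprod v.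
Proof. exact: big_cat. Qed.

Lemma tprod_ml : multilinear tprod.
Proof.
move=> a u v x y; rewrite !tprod_cat !tprod_cons linearP mulrDl mulrDr.
by rewrite -scalerAl -scalerAr.
Qed.

(* The linear map on T(M) with value f w on the word w, f multilinear. *)
Definition tlift (V : lmodType k) (f : seq M -> V) (x : tens) : V :=
  teval (@qrepr k tens_pres x) f [::].

Section LiftTheory.
Context (V : lmodType k) (f : seq M -> V).
Hypothesis fl : multilinear f.

Lemma tliftE t : tlift f (@qpi k tens_pres t) = teval t f [::].
Proof.
rewrite /tlift; have h := qrepr_pi (P := tens_pres) t.
by rewrite (teval_teq h fl).
Qed.

Lemma tlift_linear : linear (tlift f).
Proof.
move=> a x y.
rewrite -[x](qreprK (P := tens_pres)) -[y](qreprK (P := tens_pres)).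
by rewrite -(qpiZ (P := tens_pres)) -(qpiD (P := tens_pres)) !tliftE.
Qed.

Lemma tlift_prod w : tlift f (tprod w) = f w.
Proof.
pose e := foldr (fun m t => TMul (TVar m) t) TOne.
have -> : tprod w = @qpi k tens_pres (e w).
  elim: w => [|m w IH]; first by rewrite tprod_nil.
  by rewrite tprod_cons IH -(qpiM (P := tens_pres)).
rewrite tliftE; suff h u : teval (e w) f u = f (u ++ w) by rewrite h.
elim: w u => [|m w IH] u /=; first by rewrite cats0.
by rewrite IH cat_rcons.
Qed.

End LiftTheory.

Definition wspan (x : tens) : Prop :=
  exists s : seq (k * seq M), x = \sum_(p <- s) p.1 *: tprod p.2.

Lemma tens_wspan x : wspan x.
Proof.
have w1 a w : wspan (a *: tprod w) by exists [:: (a, w)]; rewrite big_seq1.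
have wD y z : wspan y -> wspan z -> wspan (y + z).
  by move=> [s ->] [t ->]; exists (s ++ t); rewrite big_cat.
have wZ a y : wspan y -> wspan (a *: y).
  move=> [s ->]; exists [seq (a * p.1, p.2) | p <- s].
  rewrite big_map scaler_sumr; apply: eq_bigr => p _ /=; by rewrite scalerA.
have w0 : wspan 0 by exists [::]; rewrite big_nil.
have wM y z : wspan y -> wspan z -> wspan (y * z).
  move=> [s ->] [t ->]; rewrite mulr_suml; elim/big_ind: _ => // p _.
  rewrite mulr_sumr; elim/big_ind: _ => // q _.
  by rewrite -scalerAl -scalerAr -tprod_cat; exact: wZ.
rewrite -[x](qreprK (P := tens_pres)); elim: (qrepr x) => {x}.
- by move=> m; have := w1 1 [:: m]; rewrite scale1r tprod_cons tprod_nil mulr1.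
- exact: w0.
- by have := w1 1 [::]; rewrite scale1r tprod_nil.
- by move=> s IH; rewrite (qpiN (P := tens_pres)) -scaleN1r; exact: wZ.
- by move=> s IHs t IHt; rewrite (qpiD (P := tens_pres)); exact: wD.
- by move=> s IHs t IHt; rewrite (qpiM (P := tens_pres)); exact: wM.
- by move=> a s IH; rewrite (qpiZ (P := tens_pres)); exact: wZ.
Qed.

Lemma tens_ext (V : lmodType k) (f g : tens -> V) : linear f -> linear g ->
  (forall w, f (tprod w) = g (tprod w)) -> f =1 g.
Proof.
move=> fl gl fg x; have [s ->] := tens_wspan x.
have l0 (h : tens -> V) : linear h -> h 0 = 0.
  by move=> hl; have := hl (-1) 0 0; rewrite !scaleN1r !addNr.
elim: s => [|p s IH]; first by rewrite big_nil !l0.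
by rewrite big_cons fl gl IH fg.
Qed.

Lemma tlift_mul (A : algType k) (f : seq M -> A) : multilinear f ->
  f [::] = 1 -> {morph f : u v / u ++ v >-> u * v} ->
  {morph tlift f : x y / x * y}.
Proof.
move=> fl f1 fM x y.
have H1 w z : tlift f (tprod w * z) = f w * tlift f z.
  have := @tens_ext A (fun z => tlift f (tprod w * z)) (fun z => f w * tlift f z).
  apply=> [a u v|a u v|v].
  - by rewrite mulrDr -scalerAr tlift_linear.
  - by rewrite tlift_linear// mulrDr scalerAr.
  - by rewrite -tprod_cat !tlift_prod// fM.
have := @tens_ext A (fun x => tlift f (x * y)) (fun x => tlift f x * tlift f y).
apply=> [a u v|a u v|v].
- by rewrite mulrDl -scalerAl tlift_linear.
- by rewrite tlift_linear// mulrDl scalerAl.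
- by rewrite H1 tlift_prod.
Qed.

(* T^n(M), the span of the products of n elements of M. *)
Definition tens_deg (n : nat) : set tens :=
  [set x | exists s : seq (k * n.-tuple M),
    x = \sum_(p <- s) p.1 *: tprod (val p.2)].

End TensorAlgebra.

Section QuotIdeal.
Context (k : fieldType) (A : algType k).
Implicit Types (I S : set A).

Definition two_sided_ideal I : Prop :=
  [/\ I 0, forall x y, I x -> I y -> I (x + y)
    & forall a x, I x -> I (a * x) /\ I (x * a)].

Definition ideal_gen S : set A :=
  [set x | forall I, two_sided_ideal I -> S `<=` I -> I x].

Lemma ideal_gen_ideal S : two_sided_ideal (ideal_gen S).
Proof.
split=> [I [] //|x y xS yS I iI SI|a x xS].
  by case: (iI) => _ iD _; apply: iD; [exact: xS|exact: yS].
by split=> I iI SI; case: (iI) => _ _ iM; have [] := iM a x (xS I iI SI).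
Qed.

Lemma ideal_gen_sub S : S `<=` ideal_gen S.
Proof. by move=> x Sx I _; apply. Qed.

Section Quotient.
Variables (I : set A) (iI : two_sided_ideal I) (I1 : ~ I 1).

Definition ideal_rel (x y : A) : Prop := I (x - y).

Lemma idealN x : I x -> I (- x).
Proof. by case: iI => _ _ iM Ix; rewrite -mulN1r; have [] := iM (-1) x Ix. Qed.

Lemma idealD x y : I x -> I y -> I (x + y).
Proof. by case: iI => _ + _; apply. Qed.

Lemma idealMl a x : I x -> I (a * x).
Proof. by case: iI => _ _ iM Ix; have [] := iM a x Ix. Qed.

Lemma idealMr a x : I x -> I (x * a).
Proof. by case: iI => _ _ iM Ix; have [] := iM a x Ix. Qed.

Lemma idealZ (a : k) x : I x -> I (a *: x).
Proof. by move=> Ix; rewrite -[x]mul1r scalerAl; exact: idealMl. Qed.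

Lemma ideal_eq x y : x = y -> ideal_rel x y.
Proof. by move=> ->; rewrite /ideal_rel subrr; case: iI. Qed.

Lemma ideal_rel_sym x y : ideal_rel x y -> ideal_rel y x.
Proof. by move=> /idealN; rewrite opprB. Qed.

Lemma ideal_rel_trans y x z : ideal_rel x y -> ideal_rel y z -> ideal_rel x z.
Proof. by move=> xy yz; have := idealD xy yz; rewrite addrA subrK. Qed.

Lemma ideal_rel_opp x y : ideal_rel x y -> ideal_rel (- x) (- y).
Proof. by move=> /idealN; rewrite opprD. Qed.

Lemma ideal_rel_add x x' y y' :
  ideal_rel x x' -> ideal_rel y y' -> ideal_rel (x + y) (x' + y').
Proof. by move=> xx yy; have := idealD xx yy; rewrite addrACA -opprD. Qed.

Lemma ideal_rel_mul x x' y y' :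
  ideal_rel x x' -> ideal_rel y y' -> ideal_rel (x * y) (x' * y').
Proof.
move=> /(idealMr y) + /(idealMl x') => /idealD /[apply].
by rewrite mulrBl mulrBr addrA subrK.
Qed.

Lemma ideal_rel_scale (a : k) x y : ideal_rel x y -> ideal_rel (a *: x) (a *: y).
Proof. by move=> /(idealZ a); rewrite scalerBr. Qed.

Lemma ideal_rel1 : ~ ideal_rel 1 0.
Proof. by rewrite /ideal_rel subr0. Qed.

Definition ideal_pres : algPres k :=
  @AlgPres k A ideal_rel 0 1 -%R +%R *%R *:%R
    (fun x => ideal_eq erefl) ideal_rel_sym ideal_rel_trans
    ideal_rel_opp ideal_rel_add ideal_rel_mul ideal_rel_scale
    (fun x y z => ideal_eq (addrA x y z)) (fun x y => ideal_eq (addrC x y))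
    (fun x => ideal_eq (add0r x)) (fun x => ideal_eq (addNr x))
    (fun x y z => ideal_eq (mulrA x y z)) (fun x => ideal_eq (mul1r x))
    (fun x => ideal_eq (mulr1 x)) (fun x y z => ideal_eq (mulrDl x y z))
    (fun x y z => ideal_eq (mulrDr x y z))
    (fun a b x => ideal_eq (scalerA a b x)) (fun x => ideal_eq (scale1r x))
    (fun a x y => ideal_eq (scalerDr a x y))
    (fun x a b => ideal_eq (scalerDl x a b))
    (fun a x y => ideal_eq (scalerAl a x y))
    (fun a x y => ideal_eq (scalerAr a x y)) ideal_rel1.

Definition quotIdeal : algType k := quotAlg ideal_pres.

End Quotient.
End QuotIdeal.

Definition subspace (k : fieldType) (V : lmodType k) (W : set V) : Prop :=
  W 0 /\ forall (a : k) u v, W u -> W v -> W (a *: u + v).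

Definition direct_sum (k : fieldType) (I : choiceType) (V : lmodType k)
    (W : I -> set V) : Prop :=
  forall v, exists! f : I -> V,
    [/\ fin_supp f, forall i, W i (f i) & v = \sum_(i \in [set: I]) f i].

Record ydModule (k : fieldType) (G : groupType) := YDModule {
  yd_mod :> lmodType k;
  yd_act : G -> {linear yd_mod -> yd_mod};
  yd_gr : G -> set yd_mod;
  yd_act1 : forall m, yd_act 1%g m = m;
  yd_actM : forall g h m, yd_act (g * h)%g m = yd_act g (yd_act h m);
  yd_gr_subspace : forall g, subspace (yd_gr g);
  yd_gr_direct : direct_sum yd_gr;
  yd_gr_act : forall h g,
    [set yd_act h m | m in yd_gr g] = yd_gr (h * g * h^-1)%g
}.

Definition yd_supp (k : fieldType) (G : groupType) (M : ydModule k G) : set G :=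
  [set g | exists2 m : M, yd_gr g m & m != 0].

Section YDBraiding.
Context (k : fieldType) (G : groupType) (M : ydModule k G).

Definition yd_comp (m : M) : G -> M :=
  sval (cid (yd_gr_direct m)).

Lemma yd_compP m : [/\ fin_supp (yd_comp m), forall g, yd_gr g (yd_comp m g)
  & m = \sum_(g \in [set: G]) yd_comp m g].
Proof. by rewrite /yd_comp; case: cid => f []. Qed.

Lemma yd_comp_uniq m (f : G -> M) : fin_supp f -> (forall g, yd_gr g (f g)) ->
  m = \sum_(g \in [set: G]) f g -> yd_comp m = f.
Proof. by move=> ff fg fm; rewrite /yd_comp; case: cid => f' [] _ /=; apply. Qed.

Lemma yd_comp_fin m : fin_supp (yd_comp m). Proof. by case: (yd_compP m). Qed.

Lemma yd_comp_linear g : linear (yd_comp^~ g).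
Proof.
move=> a x y.
have [fx gx ex] := yd_compP x; have [fy gy ey] := yd_compP y.
have fax : fin_supp (fun h => a *: yd_comp x h).
  by apply: (fin_supp_sub fx) => h ->; rewrite scaler0.
have /(congr1 (@^~ g)) // : yd_comp (a *: x + y)
    = (fun h => a *: yd_comp x h + yd_comp y h).
apply: yd_comp_uniq; first exact: fin_suppD.
  by move=> h; have [_] := yd_gr_subspace M h; apply.
rewrite fsumD// -ey {1}ex (@fsum_map _ _ _ ( *:%R a))// ?scaler0//.
exact: scalerDr.
Qed.

Lemma yd_comp_act h g m :
  yd_comp (yd_act M h m) (h * g * h^-1)%g = yd_act M h (yd_comp m g).
Proof.
have [fm gm em] := yd_compP m.
have -> : yd_comp (yd_act M h m)
    = (fun l => yd_act M h (yd_comp m (h^-1 * l * h)%g)).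
  have hK : cancel (fun l => h^-1 * l * h)%g (fun l => h * l * h^-1)%g.
    by move=> l; rewrite -!mulgA mulgV mulg1 mulVKg.
  have h'K : cancel (fun l => h * l * h^-1)%g (fun l => h^-1 * l * h)%g.
    by move=> l; rewrite -!mulgA mulVg mulg1 mulKg.
  apply: yd_comp_uniq.
  - apply: (fin_supp_sub (fin_supp_reindex hK h'K fm)) => l /= ->.
    by rewrite linear0.
  - move=> l; rewrite -{1}[l]hK -yd_gr_act.
    by exists (yd_comp m (h^-1 * l * h)%g).
  - rewrite {1}em (@fsum_map _ _ _ (yd_act M h))//.
    + apply: (reindex_fsbigT (op := +%R)
        (fun l => h^-1 * l * h)%g (fun l => yd_act M h (yd_comp m l))).
      by exists (fun l => h * l * h^-1)%g.
    + exact: linear0.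
    + exact: linearD.
by rewrite /= -!mulgA mulVg mulg1 mulKg.
Qed.

(* The image of c(x ⊗ y) in T(M): (g y) x for x homogeneous of degree g, and
   extended linearly to all x through its homogeneous components. *)
Definition yd_braid (x y : M) : tens M :=
  \sum_(g \in [set: G]) tvar (yd_act M g y) * tvar (yd_comp x g).

Lemma yd_braid_fin x y :
  fin_supp (fun g => tvar (yd_act M g y) * tvar (yd_comp x g)).
Proof. by apply: (fin_supp_sub (yd_comp_fin x)) => g ->; rewrite linear0 mulr0. Qed.

Lemma yd_braid_linl y : linear (yd_braid^~ y).
Proof.
move=> a u v; rewrite /yd_braid (@fsum_map _ _ _ ( *:%R a)).
- rewrite -fsumD.
  + apply: eq_fsbigr => g _; rewrite yd_comp_linear linearP mulrDr.
    by rewrite scalerAr.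
  + by apply: (fin_supp_sub (yd_braid_fin u y)) => g ->; rewrite scaler0.
  + exact: yd_braid_fin.
- exact: scaler0.
- exact: scalerDr.
- exact: yd_braid_fin.
Qed.

Lemma yd_braid_linr x : linear (yd_braid x).
Proof.
move=> a u v; rewrite /yd_braid (@fsum_map _ _ _ ( *:%R a)).
- rewrite -fsumD.
  + apply: eq_fsbigr => g _; rewrite !linearP mulrDl.
    by rewrite scalerAl.
  + by apply: (fin_supp_sub (yd_braid_fin x u)) => g ->; rewrite scaler0.
  + exact: yd_braid_fin.
- exact: scaler0.
- exact: scalerDr.
- exact: yd_braid_fin.
Qed.

(* The braiding applied to the letters i and i+1 (counted from 0) of a word;
   words that are too short are left unchanged. *)
Fixpoint braid_word (i : nat) (w : seq M) : tens M :=
  match i, w with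
  | 0, x :: y :: v => yd_braid x y * tprod v
  | i'.+1, x :: v => tvar x * braid_word i' v
  | _, _ => tprod w
  end.

Lemma braid_word_ml i : multilinear (braid_word i).
Proof.
elim: i => [|i IH] a u v x y.
  case: u => [|z [|z' u]] /=.
  - case: v => [|z v]; first exact: (tprod_ml a [::] [::] x y).
    by rewrite yd_braid_linl mulrDl scalerAl.
  - by rewrite yd_braid_linr mulrDl scalerAl.
  - by rewrite tprod_ml mulrDr scalerAr.
case: u => [|z u] /=; first by rewrite linearP mulrDl scalerAl.
by rewrite IH mulrDr scalerAr.
Qed.

Definition braid (i : nat) : tens M -> tens M := tlift (braid_word i).

Definition tens_act (g : G) : tens M -> tens M :=
  tlift (fun w => tprod (map (yd_act M g) w)).

Lemma tens_act_ml g : multilinear (fun w => tprod (map (yd_act M g) w)).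
Proof. by move=> a u v x y; rewrite !map_cat /= linearP tprod_ml. Qed.

Lemma tens_act_linear g : linear (tens_act g).
Proof. exact: tlift_linear (tens_act_ml g). Qed.

Lemma tens_act_prod g w : tens_act g (tprod w) = tprod (map (yd_act M g) w).
Proof. exact: tlift_prod (tens_act_ml g) w. Qed.

Lemma tens_act_mul g : {morph tens_act g : x y / x * y}.
Proof.
apply: tlift_mul; first exact: tens_act_ml.
  by rewrite tprod_nil.
by move=> u v; rewrite map_cat tprod_cat.
Qed.

HB.instance Definition _ g :=
  GRing.isLinear.Build k (tens M) (tens M) *:%R (tens_act g) (tens_act_linear g).

Lemma tens_act1 g : tens_act g 1 = 1.
Proof. by rewrite -(tprod_nil M) tens_act_prod. Qed.

Lemma tens_act_tvar g m : tens_act g (tvar m) = tvar (yd_act M g m).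
Proof.
by have := tens_act_prod g [:: m]; rewrite /= !tprod_cons !tprod_nil !mulr1.
Qed.

Lemma tens_act_id x : tens_act 1%g x = x.
Proof.
apply: (tens_ext (f := tens_act 1%g) (g := id)) => // [|w].
  exact: tens_act_linear.
rewrite tens_act_prod; congr tprod; rewrite -[RHS]map_id.
by apply: eq_map => m; exact: yd_act1.
Qed.

Lemma tens_actM g h x : tens_act (g * h)%g x = tens_act g (tens_act h x).
Proof.
apply: (tens_ext (f := tens_act (g * h)%g) (g := tens_act g \o tens_act h)).
- exact: tens_act_linear.
- by move=> a u v; rewrite /= !linearP.
- move=> w; rewrite /= !tens_act_prod -map_comp; congr tprod.
  by apply: eq_map => m; exact: yd_actM.
Qed.

Lemma tens_act_braid g i x : tens_act g (braid i x) = braid i (tens_act g x).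
Proof.
have bl j : linear (braid j) by exact: tlift_linear (braid_word_ml j).
apply: (tens_ext (f := tens_act g \o braid i) (g := braid i \o tens_act g)).
- by move=> a u v; rewrite /= bl linearP.
- by move=> a u v; rewrite /= linearP bl.
move=> w; rewrite /= tens_act_prod /braid !tlift_prod; try exact: braid_word_ml.
elim: i w => [|i IH] [|y w]; rewrite //= ?tens_act_prod//; last first.
  by rewrite tens_act_mul tens_act_tvar IH.
case: w => [|z w] /=; first by rewrite tens_act_prod.
rewrite tens_act_mul tens_act_prod; congr (_ * _).
rewrite /yd_braid (@fsum_map _ _ _ (tens_act g)); first last.
- exact: yd_braid_fin.
- exact: linearD.
- exact: linear0.
rewrite [RHS](reindex_fsbigT (op := +%R) (fun h => g * h * g^-1)%g); last first.
  exists (fun h => g^-1 * h * g)%g => h.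
    by rewrite -!mulgA mulVg mulg1 mulKg.
  by rewrite -!mulgA mulgV mulg1 mulVKg.
apply: eq_fsbigr => h _; rewrite tens_act_mul !tens_act_tvar yd_comp_act.
by rewrite -!yd_actM -!mulgA mulVg mulg1.
Qed.

End YDBraiding.

Section ReducedWords.
Context (n : nat).

Definition simple_transp (i : 'I_n) : 'S_n.+1 := tperm (inord i) (inord i.+1).

Definition perm_word (w : seq 'I_n) : 'S_n.+1 :=
  (\prod_(i <- w) simple_transp i)%g.

Definition reduced (w : seq 'I_n) : Prop :=
  forall v, perm_word v = perm_word w -> (size w <= size v)%N.

Lemma perm_word_ex (s : 'S_n.+1) : exists w, perm_word w = s.
Proof.
have gM s1 s2 : (exists w, perm_word w = s1) -> (exists w, perm_word w = s2) ->
    exists w, perm_word w = (s1 * s2)%g.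
  by move=> [u <-] [v <-]; exists (u ++ v); rewrite /perm_word big_cat.
have gS i : exists w, perm_word w = simple_transp i.
  by exists [:: i]; rewrite /perm_word big_seq1.
have g1 : exists w, perm_word w = 1%g by exists [::]; rewrite /perm_word big_nil.
have gT d i : (i + d < n.+1)%N ->
    exists w, perm_word w = tperm (inord i) (inord (i + d)).
  elim: d => [|d IH] lt; first by rewrite addn0 tperm1.
  have ltd : (i + d < n)%N by rewrite addnS in lt.
  case: d IH lt ltd => [|d] IH lt ltd.
    rewrite addn0 in ltd; have := gS (Ordinal ltd).
    by rewrite /simple_transp /= addn1.
  have {}IH := IH (ltnW ltd).
  pose t := simple_transp (Ordinal ltd).
  suff -> : tperm (inord i) (inord (i + d.+2))
      = (t * (tperm (inord i) (inord (i + d.+1)) * t))%g :> 'S_n.+1.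
    by apply: (gM); [exact: gS|apply: gM; [exact: IH|exact: gS]].
  have tV : (t^-1)%g = t by rewrite /t /simple_transp tpermV.
  rewrite -{1}tV -/(conjg _ _) tpermJ; congr tperm; rewrite /t /simple_transp /=.
    rewrite tpermD//; apply/eqP => /(congr1 val); rewrite /= !inordK; lia.
  by rewrite tpermL !addnS.
have gT2 (x y : 'I_n.+1) : exists w, perm_word w = tperm x y.
  wlog xy : x y / (x <= y)%N.
    by move=> h; case: (leqP x y) => [/h//|/ltnW/h]; rewrite tpermC.
  have := gT (y - x)%N x; rewrite subnKC// => /(_ (ltn_ord y)).
  by rewrite !inord_val.
have [ts -> _] := prod_tpermP s.
by elim/big_ind: _ => // p _; exact: gT2.
Qed.

Lemma reduced_ex (s : 'S_n.+1) : exists w, perm_word w = s /\ reduced w.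
Proof.
pose P m := `[< exists2 w, perm_word w = s & size w = m >].
have exP : exists m, P m.
  by have [w ws] := perm_word_ex s; exists (size w); apply/asboolP; exists w.
case: (ex_minnP exP) => m /asboolP[w ws wm] mP; exists w; split=> // v.
by rewrite ws wm => vs; apply: mP; apply/asboolP; exists v.
Qed.

Definition reduced_word (s : 'S_n.+1) : seq 'I_n := sval (cid (reduced_ex s)).

End ReducedWords.

Section NicholsAlgebra.
Context (k : fieldType) (G : groupType) (M : ydModule k G).

(* c_s; as c satisfies the braid equation, it does not depend on the chosen
   reduced expression of s.  Products of permutations are read from left to
   right, and so the leftmost letter acts first. *)
Definition braid_perm (n : nat) (s : 'S_n.+1) (x : tens M) : tens M :=
  foldl (fun y (i : 'I_n) => braid i y) x (reduced_word s).

(* The quantum symmetrizer of S_{n+1}, to be applied to T^{n+1}(M). *)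
Definition qsym (n : nat) (x : tens M) : tens M :=
  \sum_(s : 'S_n.+1) braid_perm s x.

(* J(M), the sum over m >= 2 of the kernels of the symmetrizers on T^m(M). *)
Definition nichols_J : set (tens M) :=
  [set x | exists (N : nat) (f : nat -> tens M),
    (forall n, (1 <= n)%N -> tens_deg n.+1 (f n) /\ qsym n (f n) = 0)
    /\ x = \sum_(1 <= n < N) f n].

(* J(M) is a two-sided ideal, so this is J(M) itself; taking the generated
   ideal lets the quotient algebra be formed without a proof of that fact. *)
Definition nichols_ideal : set (tens M) := ideal_gen nichols_J.

Lemma nichols_ideal_two_sided : two_sided_ideal nichols_ideal.
Proof. exact: ideal_gen_ideal. Qed.

Lemma nichols_ideal1 : ~ nichols_ideal 1.
Proof.
pose e (w : seq M) : k^o := if w is [::] then 1 else 0.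
have el : multilinear e.
  by move=> a [|z u] v x y /=; rewrite scaler0 addr0.
have lin := tlift_linear el.
have e1 : tlift e 1 = 1 by rewrite -(tprod_nil M) tlift_prod.
have eM : {morph tlift e : x y / x * y}.
  apply: tlift_mul => // -[|x u] v /=; first by rewrite mul1r.
  by rewrite mul0r.
have e0 : tlift e 0 = 0.
  by have := lin (-1) 0 0; rewrite !scaleN1r !addNr.
have eD x y : tlift e (x + y) = tlift e x + tlift e y.
  by have := lin 1 x y; rewrite !scale1r.
move=> /(_ [set x | tlift e x = 0]) H.
suff /eqP : tlift e 1 = 0 by rewrite e1 oner_eq0.
apply: H => [|_ [N [f [fP ->]]]].
  split=> [//|x y /= ex ey|a x /= ex]; first by rewrite eD ex ey addr0.
  by rewrite !eM ex mulr0 mul0r.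
rewrite /= (big_morph _ eD e0) big_nat big1// => n /andP[n1 _].
have [[s ->] _] := fP n n1; rewrite (big_morph _ eD e0) big1// => p _.
have := lin p.1 (tprod (val p.2)) 0; rewrite addr0 e0 addr0 => ->.
by rewrite tlift_prod//; case: (p.2) => -[|m w]//= _; rewrite scaler0.
Qed.

Definition nichols : algType k :=
  quotIdeal nichols_ideal_two_sided nichols_ideal1.

Definition npi (x : tens M) : nichols :=
  @qpi k (ideal_pres nichols_ideal_two_sided nichols_ideal1) x.

Definition nrepr (x : nichols) : tens M :=
  @qrepr k (ideal_pres nichols_ideal_two_sided nichols_ideal1) x.

Lemma nreprK : cancel nrepr npi. Proof. exact: qreprK. Qed.

Lemma npiP x y : npi x = npi y <-> nichols_ideal (x - y).
Proof. exact: qpiP. Qed.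

Lemma npiD : {morph npi : x y / x + y}. Proof. by move=> x y; exact: qpiD. Qed.
Lemma npiM : {morph npi : x y / x * y}. Proof. by move=> x y; exact: qpiM. Qed.
Lemma npiZ a : {morph npi : x / a *: x}. Proof. by move=> x; exact: qpiZ. Qed.
Lemma npi1 : npi 1 = 1. Proof. by []. Qed.

Lemma tens_act_deg g n x : tens_deg n x -> tens_deg n (tens_act g x : tens M).
Proof.
move=> [s ->].
exists [seq (p.1, map_tuple (yd_act M g) p.2) | p : k * n.-tuple M <- s].
rewrite big_map linear_sum; apply: eq_bigr => p _.
by rewrite linearZ /= tens_act_prod.
Qed.

Lemma tens_act_qsym g n x : tens_act g (qsym n x) = qsym n (tens_act g x).
Proof.
rewrite linear_sum; apply: eq_bigr => s _; rewrite /braid_perm.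
by elim: (reduced_word s) x => //= i w IH x; rewrite IH tens_act_braid.
Qed.

Lemma nichols_ideal_act g x : nichols_ideal x -> nichols_ideal (tens_act g x).
Proof.
move=> Ix I iI JI; apply: (Ix (tens_act g @^-1` I)).
  split=> [|u v /= Iu Iv|a u /= Iu].
  - by rewrite /= linear0; case: iI.
  - by rewrite linearD; exact: idealD.
  - by rewrite !tens_act_mul; split; [exact: idealMl|exact: idealMr].
move=> _ [N [f [fP ->]]]; apply: JI; exists N, (tens_act g \o f); split.
  move=> n /fP[fd fq]; split; first exact: tens_act_deg.
  by rewrite /= -tens_act_qsym fq linear0.
by rewrite linear_sum.
Qed.

Definition nichols_act (g : G) (x : nichols) : nichols :=
  npi (tens_act g (nrepr x)).

Lemma nichols_actE g x : nichols_act g (npi x) = npi (tens_act g x).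
Proof.
apply/npiP; rewrite -linearB; apply: nichols_ideal_act; apply/npiP.
by rewrite nreprK.
Qed.

End NicholsAlgebra.

Record algAction (k : fieldType) (A : algType k) (G : groupType) := AlgAction {
  aact :> G -> A -> A;
  aact_linear : forall g, linear (aact g);
  aact_mul : forall g, {morph aact g : x y / x * y};
  aact_one : forall g, aact g 1 = 1;
  aact_id : forall x, aact 1%g x = x;
  aact_comp : forall g h x, aact (g * h)%g x = aact g (aact h x)
}.

(* The smash product A # kG: x is the finite sum of the elements x g # g. *)
Record smash (k : fieldType) (A : algType k) (G : groupType)
    (al : algAction A G) := Smash {
  smash_val :> G -> A;
  smash_fin : fin_supp smash_val
}.

Section Smash.
Context (k : fieldType) (A : algType k) (G : groupType) (al : algAction A G).
Local Notation S := (smash al).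
Implicit Types x y z : S.

HB.instance Definition _ := gen_eqMixin S.
HB.instance Definition _ := gen_choiceMixin S.

Lemma smashP x y : (forall g, x g = y g) -> x = y.
Proof.
case: x y => [f ff] [h hf] /= /funext fh; subst h.
by rewrite (Prop_irrelevance ff hf).
Qed.

Lemma aact0 g : al g 0 = 0.
Proof. by have := aact_linear al g (-1) 0 0; rewrite !scaleN1r !addNr. Qed.

Lemma aactD g : {morph al g : a b / a + b}.
Proof. by move=> a b; have := aact_linear al g 1 a b; rewrite !scale1r. Qed.

Lemma aactZ g (c : k) a : al g (c *: a) = c *: al g a.
Proof. by have := aact_linear al g c a 0; rewrite aact0 !addr0. Qed.

Lemma fin_supp0 : fin_supp (fun _ : G => 0 : A).
Proof. by apply/fin_suppP; exists [::]. Qed.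

Definition szero : S := Smash al fin_supp0.

Lemma sadd_fin x y : fin_supp (fun g => x g + y g).
Proof. by apply: fin_suppD; exact: smash_fin. Qed.
Definition sadd x y : S := Smash al (sadd_fin x y).

Lemma sopp_fin x : fin_supp (fun g => - x g).
Proof. by apply: (fin_supp_sub (smash_fin x)) => g ->; rewrite oppr0. Qed.
Definition sopp x : S := Smash al (sopp_fin x).

Lemma sscale_fin (c : k) x : fin_supp (fun g => c *: x g).
Proof. by apply: (fin_supp_sub (smash_fin x)) => g ->; rewrite scaler0. Qed.
Definition sscale c x : S := Smash al (sscale_fin c x).

(* (a # g)(b # h) = a (g b) # gh, extended bilinearly: the coefficient at l is
   the sum over g h = l; see [smash_eltM]. *)
Definition smul_fun x y (l : G) : A :=
  \sum_(g \in [set: G]) x g * al g (y (g^-1 * l)%g).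

Lemma smul_funE (s : seq G) x y l : uniq s -> (forall g, g \notin s -> x g = 0) ->
  smul_fun x y l = \sum_(g <- s) x g * al g (y (g^-1 * l)%g).
Proof. by move=> us s0; apply: fsumE => // g /s0 ->; rewrite mul0r. Qed.

Lemma smul_fin x y : fin_supp (smul_fun x y).
Proof.
have /fin_suppP[s us s0] := smash_fin x; have /fin_suppP[t ut t0] := smash_fin y.
apply/fin_suppP; exists (undup [seq (g * h)%g | g <- s, h <- t]).
  exact: undup_uniq.
move=> l; rewrite mem_undup => ln; rewrite (smul_funE _ _ us s0).
rewrite big_seq big1// => g gs; rewrite t0 ?aact0 ?mulr0//.
apply: contra ln => gl; apply/allpairsP; exists (g, (g^-1 * l)%g).
by split=> //=; rewrite mulVKg.
Qed.
Definition smul x y : S := Smash al (smul_fin x y).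

Lemma selt_fin (a : A) (g : G) : fin_supp (fun l => if l == g then a else 0).
Proof.
apply/fin_suppP; exists [:: g] => // l.
by rewrite inE => /negbTE ->.
Qed.
Definition smash_elt (a : A) (g : G) : S := Smash al (selt_fin a g).

Lemma saddA : associative sadd.
Proof. by move=> x y z; apply: smashP => g; exact: addrA. Qed.
Lemma saddC : commutative sadd.
Proof. by move=> x y; apply: smashP => g; exact: addrC. Qed.
Lemma sadd0 : left_id szero sadd.
Proof. by move=> x; apply: smashP => g; exact: add0r. Qed.
Lemma saddN : left_inverse szero sopp sadd.
Proof. by move=> x; apply: smashP => g; exact: addNr. Qed.

HB.instance Definition _ := GRing.isZmodule.Build S saddA saddC sadd0 saddN.

Lemma smul1l : left_id (smash_elt 1 1%g) smul.
Proof.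
move=> x; apply: smashP => l.
rewrite /= (@smul_funE [:: 1%g])//; last by move=> g; rewrite inE /= => /negbTE ->.
by rewrite big_seq1 /= eqxx mul1r aact_id invg1 mul1g.
Qed.


Lemma smul1r : right_id (smash_elt 1 1%g) smul.
Proof.
move=> x; apply: smashP => l; rewrite /= /smul_fun (@fsum1 _ _ _ l).
  by rewrite /= mulVg eqxx aact_one mulr1.
move=> g gl /=; case: eqP => [e|_]; last by rewrite aact0 mulr0.
by rewrite -(mulVKg g l) e mulg1 eqxx in gl.
Qed.

Lemma smulDl : left_distributive smul +%R.
Proof.
move=> x y z; apply: smashP => l.
have [s [us s0 t0]] := fin_supp2 (smash_fin x) (smash_fin y).
rewrite /= (@smul_funE s x)// (@smul_funE s y)// -big_split/=.
rewrite (@smul_funE s (x + y))//; last by move=> g gs /=; rewrite s0 ?t0 ?addr0.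
by apply: eq_bigr => g _; rewrite mulrDl.
Qed.

Lemma smulDr : right_distributive smul +%R.
Proof.
move=> x y z; apply: smashP => l.
have /fin_suppP[s us s0] := smash_fin x.
rewrite /= !(@smul_funE s x)// -big_split/=.
by apply: eq_bigr => g _; rewrite aactD mulrDr.
Qed.

Lemma smulA : associative smul.
Proof.
move=> x y z; apply: smashP => l.
have /fin_suppP[s us s0] := smash_fin x; have /fin_suppP[t ut t0] := smash_fin y.
have /fin_suppP[r ur r0] := smash_fin (smul x y).
pose u := undup (r ++ [seq (g * h)%g | g <- s, h <- t]).
have uu : uniq u by exact: undup_uniq.
rewrite [RHS]/= (@smul_funE u (smul x y))//; last first.
  by move=> g; rewrite mem_undup mem_cat negb_or => /andP[/r0].
rewrite [LHS]/= (@smul_funE s x)//.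
under [RHS]eq_bigr => h _ do rewrite /= (@smul_funE s x)// mulr_suml.
rewrite exchange_big /=; apply: eq_big_seq => g gs.
rewrite (@smul_funE t y)// (big_morph (al g) (aactD g) (aact0 g)) mulr_sumr.
rewrite -(@fsumE _ _ u (fun h => x g * al g (y (g^-1 * h)%g) * al h (z (h^-1 * l)%g)))//; last first.
  move=> h; rewrite mem_undup mem_cat negb_or => /andP[_ hn].
  rewrite t0 ?aact0 ?mulr0 ?mul0r//; apply: contra hn => gh.
  by apply/allpairsP; exists (g, (g^-1 * h)%g); split=> //=; rewrite mulVKg.
rewrite (reindex_fsbigT (op := +%R) (fun h => g * h)%g); last first.
  by exists (fun h => g^-1 * h)%g => h; rewrite ?mulKg ?mulVKg.
rewrite (@fsumE _ _ t)//; last first.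
  by move=> h hn; rewrite /= mulKg t0// aact0 mulr0 mul0r.
apply: eq_bigr => h _; rewrite mulKg aact_mul mulrA aact_comp invgM.
by rewrite !mulgA.
Qed.

Lemma smash1_neq0 : smash_elt 1 1%g != 0.
Proof.
apply/eqP => /(congr1 (fun x : S => x 1%g)) /= /eqP.
by rewrite eqxx oner_eq0.
Qed.

HB.instance Definition _ := GRing.Zmodule_isNzRing.Build S
  smulA smul1l smul1r smulDl smulDr smash1_neq0.

Lemma sscaleA a b x : sscale a (sscale b x) = sscale (a * b) x.
Proof. by apply: smashP => g; exact: scalerA. Qed.
Lemma sscale1 : left_id 1 sscale.
Proof. by move=> x; apply: smashP => g; exact: scale1r. Qed.
Lemma sscaleDr : right_distributive sscale +%R.
Proof. by move=> a x y; apply: smashP => g; exact: scalerDr. Qed.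
Lemma sscaleDl x : {morph sscale^~ x : a b / a + b}.
Proof. by move=> a b; apply: smashP => g; exact: scalerDl. Qed.

HB.instance Definition _ := GRing.Zmodule_isLmodule.Build k S
  sscaleA sscale1 sscaleDr sscaleDl.

Lemma sscaleAl (c : k) x y : c *: (x * y) = (c *: x) * y.
Proof.
apply: smashP => l; have /fin_suppP[s us s0] := smash_fin x.
rewrite [LHS]/= (@smul_funE s x)// [RHS]/= (@smul_funE s (sscale c x))//; last first.
  by move=> g gs /=; rewrite s0// scaler0.
by rewrite scaler_sumr; apply: eq_bigr => g _; rewrite scalerAl.
Qed.
HB.instance Definition _ := GRing.Lmodule_isLalgebra.Build k S sscaleAl.

Lemma sscaleAr (c : k) x y : c *: (x * y) = x * (c *: y).
Proof.
apply: smashP => l; have /fin_suppP[s us s0] := smash_fin x.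
rewrite [LHS]/= (@smul_funE s x)// [RHS]/= (@smul_funE s x)//.
by rewrite scaler_sumr; apply: eq_bigr => g _; rewrite aactZ scalerAr.
Qed.
HB.instance Definition _ := GRing.Lalgebra_isAlgebra.Build k S sscaleAr.

Lemma smash_eltM a g b h :
  smash_elt a g * smash_elt b h = smash_elt (a * al g b) (g * h)%g.
Proof.
apply: smashP => l.
rewrite /= (@smul_funE [:: g])//; last by move=> g'; rewrite inE /= => /negbTE ->.
rewrite big_seq1 /= eqxx; case: (eqVneq l (g * h)%g) => [->|lgh].
  by rewrite mulKg eqxx.
case: eqP => [e|_]; last by rewrite aact0 mulr0.
by rewrite -e mulVKg eqxx in lgh.
Qed.

End Smash.

Section Bosonization.
Context (k : fieldType) (G : groupType) (M : ydModule k G).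

Lemma nichols_act_linear g : linear (@nichols_act k G M g).
Proof.
move=> a x y; rewrite -[x]nreprK -[y]nreprK -npiZ -npiD !nichols_actE.
by rewrite linearP npiD npiZ.
Qed.

Lemma nichols_act_mul g : {morph @nichols_act k G M g : x y / x * y}.
Proof.
move=> x y; rewrite -[x]nreprK -[y]nreprK -npiM !nichols_actE.
by rewrite tens_act_mul npiM.
Qed.

Lemma nichols_act_one g : @nichols_act k G M g 1 = 1.
Proof. by rewrite -npi1 nichols_actE tens_act1. Qed.

Lemma nichols_act_id (x : nichols M) : nichols_act 1%g x = x.
Proof. by rewrite -[x]nreprK nichols_actE tens_act_id. Qed.

Lemma nichols_act_comp g h (x : nichols M) :
  nichols_act (g * h)%g x = nichols_act g (nichols_act h x).
Proof. by rewrite -[x]nreprK !nichols_actE tens_actM. Qed.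

Definition nichols_action : algAction (nichols M) G :=
  AlgAction nichols_act_linear nichols_act_mul nichols_act_one
    nichols_act_id nichols_act_comp.

Definition bosonization : algType k := smash nichols_action.

End Bosonization.

Section GKDimension.
Context (k : fieldType) (A : algType k).

Definition lin_indep (m : nat) (v : 'I_m -> A) : Prop :=
  forall c : 'I_m -> k, \sum_i c i *: v i = 0 -> forall i, c i = 0.

Definition in_span (s : seq A) (x : A) : Prop :=
  exists c : 'I_(size s) -> k, x = \sum_i c i *: s`_i.

Definition dim_span (s : seq A) : nat :=
  \max_(m < (size s).+1 |
    `[< exists v : 'I_m -> A, (forall i, in_span s (v i)) /\ lin_indep v >]) m.

Fixpoint products (s : seq A) (n : nat) : seq A :=
  if n is n'.+1 then [seq a * b | a <- s, b <- products s n'] else [:: 1].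

(* A spanning family of k + V + V^2 + ... + V^n for V the span of s. *)
Definition products_upto (s : seq A) (n : nat) : seq A :=
  flatten [seq products s i | i <- iota 0 n.+1].

End GKDimension.

(* The supremum over the finite-dimensional subspaces V of A of
   limsup_n log_n dim (k + V + ... + V^n). *)
Definition GKdim (R : realType) (k : fieldType) (A : algType k) : \bar R :=
  ereal_sup [set limn_esup (fun n =>
    (ln (dim_span (products_upto s n))%:R / ln n%:R : R)%:E)
    | s in [set: seq A]].

Definition finitely_generated (G : groupType) : Prop :=
  exists s : seq G, forall H : set G,
    H 1%g -> (forall g h, H g -> H h -> H (g * h)%g) ->
    (forall g, H g -> H g^-1%g) -> (forall g, g \in s -> H g) ->
    forall g, H g.

Definition conj_class (G : groupType) (x : G) : set G :=
  [set (g * x * g^-1)%g | g in [set: G]].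

(* Main.v *)
Require Import Defs.
From HB Require Import structures.
From mathcomp Require Import all_boot all_order all_algebra all_fingroup.
From mathcomp Require Import zify.
From mathcomp Require Import boolp classical_sets functions cardinality fsbigop.
From mathcomp Require Import reals ereal normedtype sequences exp.

(* For a linear form f on M supported on one degree g there is a skew derivation
   D of T(M) with D(xy) = x D(y) + D(x) (g y) and D = f on M.  The tensors on which
   all iterated derivations have zero counit form a two-sided ideal, and it contains
   the kernel of each quantum symmetrizer because n derivations applied to a tensor
   of degree n compute the pairing of n forms with its symmetrization.  So such
   derivations detect linear independence in B(M).

   Let m <> 0 be homogeneous of degree x.  As the class of x is infinite and G is
   finitely generated, words of length <= N give N + 1 elements g with distinct
   g x g^-1, and g m = g # m # g^-1 lies in the (2N + 1)-st power of a fixed finite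
   set of generators.  Take N = d r, split these vectors into d blocks of size r,
   and form the r^d products of d factors, one from each block.  In the matrix of
   the iterated derivations dual to them the diagonal entries are 1, since the
   degrees are distinct, and a row has at most d! nonzero entries, since the order in
   which the letters are removed determines the degrees of the derivations.  The
   rank is then at least r^d / d!, while the products have length O(d^2 r); hence
   the growth exceeds every polynomial. *)

Set Implicit Arguments.
Unset Strict Implicit.
Unset Printing Implicit Defensive.

Import Order.TTheory GRing.Theory Num.Theory.

Local Open Scope ring_scope.

(** * Homogeneous forms and skew derivations *)

Section LinearSeparation.
Local Open Scope classical_set_scope.

(** Zorn's lemma gives a maximal subspace W avoiding [m]. It is a complement of the line through
    [m], and f reads off the coefficient of [m]. *)
Lemma linear_separation (k : fieldType) (V : lmodType k) (m : V) : m != 0 ->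
  exists f : V -> k^o, linear f /\ f m = 1.
Proof.
(* [P] does not ask for 0 in W, so that the union of the empty chain, which is empty, satisfies
   it. *)
move=> m0; pose P (W : set V) :=
  (forall (a : k) u v, W u -> W v -> W (a *: u + v)) /\ ~ W m.
have [|W [[Wlin Wm] maxW]] := @Zorn_bigcup V P.
  move=> F FP tF; split; last by move=> [A FA Am]; have [_] := FP A FA; apply.
  move=> a u v [A FA Au] [B FB Bv].
  have [AB|BA] := tF A B FA FB.
    by exists B => //; apply: (FP B FB).1 => //; exact: AB.
  by exists A => //; apply: (FP A FA).1 => //; exact: BA.
have W0 : W 0.
  have [W0|//] := pselect (W = set0); last first.
    move/eqP/set0P => [u Wu]; have := Wlin (-1) u u Wu Wu.
    by rewrite scaleN1r addNr.
  exfalso; apply: (maxW [set 0]).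
    rewrite W0; split=> [//|h].
    by have : (set0 : set V) 0 by apply: h.
  split=> [a u v /= -> ->|/= mE]; first by rewrite scaler0 addr0.
  by rewrite mE eqxx in m0.
(* If v is outside W, then W + k v contains [m] by maximality, and the relation m - a v in W, where
   a is nonzero, is solved for v. *)
have ex v : exists c, W (v - c *: m).
  have [Wv|nWv] := pselect (W v); first by exists 0; rewrite scale0r subr0.
  pose W' := [set u | exists2 a : k, W (u - a *: v) & True].
  have : ~ P W'.
    apply: maxW; split => [u Wu|WW]; first by exists 0; rewrite // scale0r subr0.
    by apply/nWv/WW; exists 1 => //; rewrite scale1r subrr.
  move/not_andP => [|/contrapT[a Wa _]].
    case=> a u w [b Wb _] [c Wc _]; exists (a * b + c) => //.
    by have := Wlin a _ _ Wb Wc; rewrite scalerBr addrACA -opprD scalerA -scalerDl.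
  have a0 : a != 0.
    by apply/eqP => a0; move: Wa; rewrite a0 scale0r subr0.
  exists a^-1; have := Wlin (- a^-1) _ _ Wa W0.
  by rewrite addr0 scalerBr !scaleNr scalerA mulVf// scale1r opprK addrC.
have {}ex v : {c : k^o | W (v - c *: m)} by exact: cid (ex v).
have uniq v (c c' : k) : W (v - c *: m) -> W (v - c' *: m) -> c = c'.
  move=> Wc Wc'; have [//|/eqP] := pselect (c = c').
  rewrite -subr_eq0 => cc; have := Wlin (-1) _ _ Wc Wc'.
  rewrite scaleN1r opprB addrA subrK -scalerBl => Wcc.
  have := Wlin (c - c')^-1 _ _ Wcc W0.
  by rewrite addr0 scalerA mulVf// scale1r.
exists (fun v => sval (ex v)); split=> [a u v|].
  apply: uniq (svalP (ex _)) _.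
  have := Wlin a _ _ (svalP (ex u)) (svalP (ex v)).
  by rewrite scalerBr addrACA -opprD scalerA -scalerDl.
by apply: uniq (svalP (ex _)) _; rewrite scale1r subrr.
Qed.

End LinearSeparation.

Section Functionals.
Local Open Scope classical_set_scope.
Context (k : fieldType) (G : groupType) (M : ydModule k G).
Implicit Types (g h : G) (m : M).

Lemma yd_comp_homog g m : yd_gr g m ->
  yd_comp m = (fun h => if h == g then m else 0).
Proof.
move=> gm; apply: yd_comp_uniq.
- apply/fin_suppP; exists [:: g] => // h.
  by rewrite inE => /negbTE ->.
- move=> h; case: eqP => [->//|_]; by have [] := yd_gr_subspace M h.
- by rewrite (@fsum1 _ _ _ g) ?eqxx// => h /negbTE ->.
Qed.

(** Homogeneous elements of the graded dual of M. The degree is data, since the zero form does not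
    determine one. *)
Record homog_form := HomogForm {
  hf :> M -> k^o;
  hdeg : G;
  hf_linear : linear hf;
  hf_homog : forall m g, g != hdeg -> hf (yd_comp m g) = 0
}.
Implicit Types p q : homog_form.

HB.instance Definition _ p := GRing.isLinear.Build k M k^o *:%R (hf p) (hf_linear p).

Lemma homog_formP p q : hf p =1 hf q -> hdeg p = hdeg q -> p = q.
Proof.
case: p q => [f a fl fh] [f' a' fl' fh'] /= /funext ff aa; subst f' a'.
by rewrite (Prop_irrelevance fl fl') (Prop_irrelevance fh fh').
Qed.

Lemma hf_comp p m : p (yd_comp m (hdeg p)) = p m.
Proof.
have [fm _ {2}->] := yd_compP m.
rewrite (@fsum_map _ _ _ (hf p)) ?linear0//; last exact: linearD.
by rewrite (@fsum1 _ _ _ (hdeg p))// => g /hf_homog.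
Qed.

Lemma hf_neq p g m : yd_gr g m -> g != hdeg p -> p m = 0.
Proof. by move=> gm; have := @hf_homog p m g; rewrite (yd_comp_homog gm) eqxx. Qed.

(** A separating form is composed with the projection onto degree g. *)
Lemma hf_exists g m : yd_gr g m -> m != 0 ->
  exists p, hdeg p = g /\ p m = 1.
Proof.
move=> gm /linear_separation[f [fl fm]].
have f0 : f 0 = 0 by have := fl (-1) 0 0; rewrite !scaleN1r !addNr.
pose f' m := f (yd_comp m g).
have f'l : linear f' by move=> a u v; rewrite /f' yd_comp_linear fl.
have f'h m' h : h != g -> f' (yd_comp m' h) = 0.
  move=> hg; rewrite /f'; have [_ /(_ h)/yd_comp_homog -> _] := yd_compP m'.
  by rewrite eq_sym (negbTE hg).
exists (HomogForm f'l f'h); split=> //=.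
by rewrite /f' (yd_comp_homog gm) eqxx.
Qed.

Lemma hf_act_linear p h : linear (p \o yd_act M h : M -> k^o).
Proof. by move=> a u v; rewrite /= !linearP. Qed.

Lemma hf_act_homog p h m g : g != (h^-1 * hdeg p * h)%g ->
  (p \o yd_act M h : M -> k^o) (yd_comp m g) = 0.
Proof.
move=> gn; rewrite /= -yd_comp_act hf_homog//; apply: contra gn => /eqP <-.
by rewrite -!mulgA mulVg mulg1 mulKg.
Qed.

(** The right action of G on forms dual to its action on M. *)
Definition hact p h := HomogForm (hf_act_linear p h) (@hf_act_homog p h).

Lemma hact1 p : hact p 1%g = p.
Proof.
by apply: homog_formP => [m|] /=; rewrite ?yd_act1// invg1 mul1g mulg1.
Qed.

Lemma hactM p g h : hact p (g * h)%g = hact (hact p g) h.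
Proof.
by apply: homog_formP => [m|] /=; rewrite ?yd_actM// invgM !mulgA.
Qed.

(* The skew derivation of T(M) extending the form p: Leibniz rule [tderM]. *)
Fixpoint tder_word p (w : seq M) : tens M :=
  if w is m :: w' then
    tvar m * tder_word p w' + p m *: tens_act (hdeg p) (tprod w')
  else 0.

Lemma tder_word_ml p : multilinear (tder_word p).
Proof.
move=> a; elim=> [|z u IH] v x y /=.
  by rewrite !linearP /= mulrDl -!scalerAl scalerDl scalerDr -scalerA addrACA.
rewrite IH mulrDr -scalerAr tprod_ml linearP scalerDr scalerDr !scalerA.
by rewrite mulrC addrACA.
Qed.

Definition tder p : tens M -> tens M := tlift (tder_word p).

Lemma tder_linear p : linear (tder p).
Proof. exact: tlift_linear (@tder_word_ml p). Qed.

HB.instance Definition _ p :=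
  GRing.isLinear.Build k (tens M) (tens M) *:%R (tder p) (tder_linear p).

Lemma tder_prod p w : tder p (tprod w) = tder_word p w.
Proof. exact: tlift_prod (@tder_word_ml p) w. Qed.

Lemma tder1 p : tder p 1 = 0.
Proof. by rewrite -(tprod_nil M) tder_prod. Qed.

Lemma tder_tvarM p m x :
  tder p (tvar m * x) = tvar m * tder p x + p m *: tens_act (hdeg p) x.
Proof.
apply: (tens_ext (f := fun x => tder p (tvar m * x))
  (g := fun x => tvar m * tder p x + p m *: tens_act (hdeg p) x)).
- by move=> a u v; rewrite mulrDr -scalerAr linearP.
- move=> a u v; rewrite !linearP mulrDr -scalerAr !scalerDr !scalerA.
  rewrite [X in X *: tens_act _ u]mulrC; exact: addrACA.
- by move=> w; rewrite -tprod_cons !tder_prod.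
Qed.

Lemma tder_tvar p m : tder p (tvar m) = p m *: 1.
Proof. by rewrite -[tvar m]mulr1 tder_tvarM tder1 mulr0 add0r tens_act1. Qed.

Lemma tderM p x y : tder p (x * y) = x * tder p y + tder p x * tens_act (hdeg p) y.
Proof.
apply: (tens_ext (f := fun x => tder p (x * y))
  (g := fun x => x * tder p y + tder p x * tens_act (hdeg p) y)).
- by move=> a u v; rewrite mulrDl -scalerAl linearP.
- by move=> a u v; rewrite linearP !mulrDl -!scalerAl scalerDr addrACA.
elim=> [|m w IH]; first by rewrite tprod_nil tder1 !mul1r mul0r addr0.
rewrite tprod_cons -mulrA !tder_tvarM IH mulrDr mulrDl !mulrA -addrA.
by rewrite tens_act_mul -scalerAl.
Qed.

Lemma tder_act p g h x :
  tder p (tens_act h x) = tens_act h (tder (hact p h) x).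
Proof.
apply: (tens_ext (f := tder p \o tens_act h) (g := tens_act h \o tder (hact p h))).
- by move=> a u v; rewrite /= !linearP.
- by move=> a u v; rewrite /= !linearP.
elim=> [|m w /= IH] /=; first by rewrite tprod_nil tens_act1 !tder1 linear0.
rewrite tprod_cons tens_act_mul tens_act_tvar !tder_tvarM IH linearD /=.
rewrite tens_act_mul tens_act_tvar linearZ /= -!tens_actM.
by rewrite -mulgA mulVKg.
Qed.

Definition counit_word (w : seq M) : k^o := if w is [::] then 1 else 0.

Lemma counit_word_ml : multilinear counit_word.
Proof. by move=> a [|z u] v x y /=; rewrite scaler0 addr0. Qed.

Definition counit : tens M -> k^o := tlift counit_word.

Lemma counit_linear : linear counit.
Proof. exact: tlift_linear counit_word_ml. Qed.

HB.instance Definition _ :=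
  GRing.isLinear.Build k (tens M) k^o *:%R counit counit_linear.

Lemma counit_prod w : counit (tprod w) = counit_word w.
Proof. exact: tlift_prod counit_word_ml w. Qed.

Lemma counitM : {morph counit : x y / x * y}.
Proof.
apply: tlift_mul => [||[|x u] v] //=; first exact: counit_word_ml.
  by rewrite mul1r.
by rewrite mul0r.
Qed.

Lemma counit1 : counit 1 = 1.
Proof. by rewrite -(tprod_nil M) counit_prod. Qed.

Lemma counit_act g x : counit (tens_act g x) = counit x.
Proof.
apply: (tens_ext (f := counit \o tens_act g) (g := counit)).
- by move=> a u v; rewrite /= !linearP.
- by move=> a u v; rewrite /= !linearP.
by move=> [|m w]; rewrite /= tens_act_prod !counit_prod.
Qed.

(** The last form of [l] acts first. *)
Definition iter_der (l : seq homog_form) (x : tens M) : k^o := counit (foldr tder x l).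

Lemma iter_der_linear l : linear (iter_der l).
Proof.
move=> a u v; rewrite /iter_der -linearP; congr counit.
by elim: l => //= p l ->; rewrite linearP.
Qed.
HB.instance Definition _ l :=
  GRing.isLinear.Build k (tens M) k^o *:%R (iter_der l) (iter_der_linear l).

Lemma iter_derD l : {morph iter_der l : x y / x + y}.
Proof. exact: linearD. Qed.

Lemma iter_der_rcons l p x : iter_der (rcons l p) x = iter_der l (tder p x).
Proof. by rewrite /iter_der foldr_rcons. Qed.

Definition der_radical : set (tens M) := [set x | forall l, iter_der l x = 0].

Lemma der_radical_act g x : der_radical x -> der_radical (tens_act g x).
Proof.
move=> xK l; elim/last_ind: l x xK => [|l p IH] x xK.
  by rewrite /iter_der/= counit_act; exact: (xK [::]).
rewrite iter_der_rcons tder_act//; apply: IH => l'.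
by rewrite -iter_der_rcons.
Qed.

(** Induction on the list of derivations through the Leibniz rule. For a product a x it leaves a
    term D(a) (g x), which is why stability under G comes first. *)
Lemma der_radical_ideal : two_sided_ideal der_radical.
Proof.
split=> [l|x y xK yK l|a x xK]; first exact: linear0.
  by rewrite iter_derD xK yK addr0.
have tderK p y : der_radical y -> der_radical (tder p y).
  by move=> yK l; rewrite -iter_der_rcons.
split=> l; elim/last_ind: l a x xK => [|l p IH] a x xK.
- by rewrite /iter_der/= counitM (xK [::] : counit x = 0) mulr0.
- rewrite iter_der_rcons tderM iter_derD !IH ?addr0//; last exact: tderK.
  exact: der_radical_act.
- by rewrite /iter_der/= counitM (xK [::] : counit x = 0) mul0r.
- by rewrite iter_der_rcons tderM iter_derD !IH ?addr0//; exact: tderK.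
Qed.

End Functionals.

(** * Braid words of permutations *)

Section Exchange.
Context (n : nat).
Implicit Types (i : 'I_n) (a b : 'I_n.+1) (w : seq 'I_n).

Lemma perm_word_cons i w :
  perm_word (i :: w) = (simple_transp i * perm_word w)%g.
Proof. by rewrite /perm_word big_cons. Qed.

Lemma simple_transpE i a : simple_transp i a =
  (if a == i :> nat then i.+1 else if a == i.+1 :> nat then i : nat else a) :> nat.
Proof.
have li : (i < n.+1)%N by rewrite ltnW // ltnS.
have li1 : (i.+1 < n.+1)%N by exact: ltn_ord.
have ea m (h : (m < n.+1)%N) : (a == inord m) = (a == m :> nat).
  by rewrite -val_eqE /= inordK.
rewrite /simple_transp permE /= !ea//.
case: eqP => _; first exact: inordK.
by case: eqP => _ //; exact: inordK.
Qed.

Lemma simple_transp_inversion i a b : (a < b)%N ->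
  (simple_transp i b < simple_transp i a)%N -> a = i :> nat /\ b = i.+1 :> nat.
Proof.
move=> ab; rewrite !simple_transpE.
case: (nat_of_ord a =P i) => ?; case: (nat_of_ord b =P i) => ?;
  case: (nat_of_ord a =P i.+1) => ?; case: (nat_of_ord b =P i.+1) => ?; lia.
Qed.

(** The strong exchange property: while the pair a, b is followed through the word, some letter
    reverses it. Deleting that letter multiplies by [tperm a b]. *)
Lemma exchange w a b : (a < b)%N -> (perm_word w b < perm_word w a)%N ->
  exists v, perm_word v = (tperm a b * perm_word w)%g /\ (size v < size w)%N.
Proof.
elim: w a b => [|i w IH] a b ab.
  by rewrite /perm_word big_nil !perm1 ltnNge (ltnW ab).
rewrite perm_word_cons !permM => wab.
have sV : (simple_transp i)^-1%g = simple_transp i by rewrite /simple_transp tpermV.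
have : simple_transp i a != simple_transp i b.
  by rewrite (inj_eq perm_inj); apply: contraTneq ab => ->; rewrite ltnn.
rewrite -val_eqE /= neq_ltn => /orP[sab|sba].
  have [v [vE vs]] := IH _ _ sab wab; exists (i :: v); split; last by rewrite ltnS.
  have ss : (simple_transp i * simple_transp i = 1)%g by rewrite -{1}sV mulVg.
  rewrite perm_word_cons vE -tpermJ /conjg sV !mulgA.
  by rewrite ss mul1g.
have [ai bi] := simple_transp_inversion ab sba.
exists w; split => //=.
have -> : tperm a b = simple_transp i.
  by rewrite /simple_transp -bi -ai !inord_val.
by rewrite mulgA -{1}sV mulVg mul1g.
Qed.

(** If the tail reversed the pair i, i+1, exchange would give a shorter word for the same
    permutation. *)
Lemma reduced_cons i w : reduced (i :: w) ->
  reduced w /\ (perm_word w (inord i) < perm_word w (inord i.+1))%N.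
Proof.
move=> r; split.
  move=> v vE; have := r (i :: v); rewrite !perm_word_cons vE => /(_ erefl).
  by rewrite ltnS.
have li : (i < n.+1)%N by rewrite ltnW // ltnS.
have lt : ((inord i : 'I_n.+1) < (inord i.+1 : 'I_n.+1))%N.
  by rewrite !inordK// ltnS.
rewrite ltn_neqAle leqNgt; apply/andP; split.
  rewrite val_eqE (inj_eq perm_inj); apply: contraTneq lt => ->.
  by rewrite ltnn.
apply/negP => /(exchange lt)[v [vE vs]].
by have := r v; rewrite perm_word_cons vE => /(_ erefl); rewrite leqNgt ltnS (ltnW vs).
Qed.

End Exchange.

(** * The symmetrizer as an iterated skew derivation *)

Section DualBraiding.
Context (k : fieldType) (G : groupType) (M : ydModule k G).
Local Notation form := (homog_form M).
Implicit Types (p q : form) (l : seq form).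

Fixpoint pairing_word l (w : seq M) : k^o :=
  match l, w with
  | [::], [::] => 1
  | p :: l', m :: w' => p m * pairing_word l' w'
  | _, _ => 0
  end.

Lemma pairing_word_ml l : multilinear (pairing_word l).
Proof.
move=> a u v x y; elim: l u => [|p l IH] [|z u] /=; rewrite ?scaler0 ?addr0//.
  by rewrite linearP mulrDl -scalerAl.
by rewrite IH mulrDr -scalerAr.
Qed.

Definition pairing l : tens M -> k^o := tlift (pairing_word l).

Lemma pairing_linear l : linear (pairing l).
Proof. exact: tlift_linear (@pairing_word_ml l). Qed.
HB.instance Definition _ l :=
  GRing.isLinear.Build k (tens M) k^o *:%R (pairing l) (pairing_linear l).

Lemma pairing_prod l w : pairing l (tprod w) = pairing_word l w.
Proof. exact: tlift_prod (@pairing_word_ml l) w. Qed.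

Lemma pairing_consM p l m x : pairing (p :: l) (tvar m * x) = p m * pairing l x.
Proof.
apply: (tens_ext (f := fun x => pairing (p :: l) (tvar m * x))
  (g := fun x => p m * pairing l x : k^o)) => [a u v|a u v|w].
- by rewrite mulrDr -scalerAr linearP.
- by rewrite linearP mulrDr -scalerAr.
- by rewrite -tprod_cons !pairing_prod.
Qed.

Lemma pairing_nilM m x : pairing [::] (tvar m * x) = 0.
Proof.
apply: (tens_ext (f := fun x => pairing [::] (tvar m * x))
  (g := fun x => 0 : k^o)) => [a u v|a u v|w].
- by rewrite mulrDr -scalerAr linearP.
- by rewrite scaler0 addr0.
- by rewrite -tprod_cons pairing_prod.
Qed.

(* The transpose of [braid i]. *)
Fixpoint hbraid (i : nat) l : seq form :=
  match i, l with
  | 0, p :: q :: l' => q :: hact p (hdeg q) :: l'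
  | i'.+1, p :: l' => p :: hbraid i' l'
  | _, _ => l
  end.

Lemma size_hbraid i l : size (hbraid i l) = size l.
Proof. by elim: i l => [|i IH] [|p l] //=; [case: l|rewrite IH]. Qed.

Lemma nth_hbraid p0 i l j : (i.+1 < size l)%N -> nth p0 (hbraid i l) j =
  if j == i then nth p0 l i.+1
  else if j == i.+1 then hact (nth p0 l i) (hdeg (nth p0 l i.+1)) else nth p0 l j.
Proof.
elim: i l j => [|i IH] [|p [|q l]] [|[|j]] //= il; rewrite (IH (q :: l))//.
Qed.

(** The form q kills every component of x outside its own degree, so a single summand of c(x ⊗ y)
    survives. *)
Lemma pairing_yd_braid l x y t : pairing l (yd_braid x y * t) =
  if l is p :: q :: l' then p (yd_act M (hdeg q) y) * q x * pairing l' t else 0.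
Proof.
rewrite /yd_braid (@fsum_map _ _ _ (fun z => pairing l (z * t)))//; first last.
- exact: yd_braid_fin.
- by move=> u v; rewrite mulrDl; exact: linearD.
- by rewrite mul0r; exact: linear0.
case: l => [|p [|q l]].
- by apply: fsbig1 => g _; rewrite -mulrA pairing_nilM.
- by apply: fsbig1 => g _; rewrite -mulrA pairing_consM pairing_nilM mulr0.
rewrite (@fsum1 _ _ _ (hdeg q)) => [|g gq].
  by rewrite /= -[_ * _ * t]mulrA !pairing_consM hf_comp mulrA.
by rewrite /= -[_ * _ * t]mulrA !pairing_consM hf_homog// mul0r mulr0.
Qed.

Lemma pairing_braid_word i l w : pairing l (braid_word i w) = pairing_word (hbraid i l) w.
Proof.
elim: i l w => [|i IH] l [|x w] /=; rewrite ?pairing_prod.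
- by case: l => [|p [|q l]].
- case: w => [|y w] /=; first by rewrite pairing_prod; case: l => [|p [|q l]] //=; rewrite !mulr0.
  rewrite pairing_yd_braid; case: l => [|p [|q l]] //=; first by rewrite mulr0.
  by rewrite pairing_prod mulrA [q x * _]mulrC.
- by case: l.
case: l => [|p l] /=; first by rewrite pairing_nilM.
by rewrite pairing_consM IH.
Qed.

Lemma pairing_braid i l x : pairing l (braid i x) = pairing (hbraid i l) x.
Proof.
apply: (tens_ext (f := pairing l \o braid i) (g := pairing (hbraid i l))).
- move=> a u v; rewrite /= /braid tlift_linear ?linearP//.
  exact: braid_word_ml.
- exact: linearP.
move=> w /=; rewrite /braid tlift_prod; last exact: braid_word_ml.
by rewrite pairing_braid_word pairing_prod.
Qed.

Lemma pairing_braids n (w : seq 'I_n) l x :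
  pairing l (foldl (fun y (i : 'I_n) => braid i y) x w)
  = pairing (foldr (fun (i : 'I_n) l => hbraid i l) l w) x.
Proof. by elim: w x => //= i w IH x; rewrite IH pairing_braid. Qed.

(* In the braid of s, strand j of the output is the form p_(s j), twisted by
   the degrees of the forms with a larger index which end up to its left. *)
Definition crossing n (s : 'S_n) (g : 'I_n -> G) (j : 'I_n) : G :=
  (\big[*%g/1]_(a < n | (s j < a)%N && ((s^-1)%g a < j)%N) g a)%g.

Definition hperm n (s : 'S_n) (p : 'I_n -> form) (j : 'I_n) : form :=
  hact (p (s j)) (crossing s (fun a => hdeg (p a)) j).

(** The product over [P] ends with u, so appending u^-1 g_b u puts g_b at its place in the
    increasing order. In a braid, such a conjugate is the degree of an already twisted form. *)
Lemma prodg_insert n (P : pred 'I_n) (b : 'I_n) (g : 'I_n -> G) : ~~ P b ->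
  let u := (\big[*%g/1]_(a < n | P a && (b < a)%N) g a)%g in
  ((\big[*%g/1]_(a < n | P a) g a) * (u^-1 * g b * u))%g
  = (\big[*%g/1]_(a < n | P a || (a == b)) g a)%g.
Proof.
case: n P b g => [|n] P b g; first by case: b.
move=> Pb /=.
have split (Q : pred 'I_n.+1) : (\big[*%g/1]_(a < n.+1 | Q a) g a)%g =
   ((\big[*%g/1]_(0 <= a < b | Q (inord a)) g (inord a)) *
   ((if Q b then g b else 1) *
   (\big[*%g/1]_(b.+1 <= a < n.+1 | Q (inord a)) g (inord a))))%g.
  transitivity (\big[*%g/1%g]_(0 <= a < n.+1 | Q (inord a)) g (inord a)).
    by rewrite big_mkord; apply: eq_big => [a|a _]; rewrite inord_val.
  rewrite (@big_cat_nat _ _ _ b)//=; last exact: ltnW.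
  congr (_ * _)%g; rewrite big_ltn_cond// inord_val.
  by case: ifP => // _; rewrite mul1g.
have below (a : nat) : (a < b)%N -> (inord a == b) = false /\ (b < (inord a : 'I_n.+1))%N = false.
  move=> ab; have an : (a < n.+1)%N by exact: ltn_trans ab _.
  by rewrite -val_eqE /= !inordK// (ltn_eqF ab) ltnNge (ltnW ab).
have above (a : nat) : (b < a < n.+1)%N -> (inord a == b) = false /\ (b < (inord a : 'I_n.+1))%N = true.
  by move=> /andP[ba an]; rewrite -val_eqE /= !inordK// (gtn_eqF ba).
rewrite !split (negbTE Pb) /= eqxx !mul1g.
have -> : (\big[*%g/1]_(0 <= a < b | P (inord a) && (b < (inord a : 'I_n.+1))%N) g (inord a) = 1)%g.
  rewrite big_nat_cond big1// => a /andP[/andP[_ /below[_ ->]]].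
  by rewrite andbF.
rewrite mul1g.
have -> : (\big[*%g/1]_(b.+1 <= a < n.+1 | P (inord a) && (b < (inord a : 'I_n.+1))%N) g (inord a)
    = \big[*%g/1]_(b.+1 <= a < n.+1 | P (inord a)) g (inord a))%g.
  rewrite [LHS]big_nat_cond [RHS]big_nat_cond; apply: eq_bigl => a.
  by have [/above[_ ->]|] := boolP (b < a < n.+1)%N; rewrite //= andbT.
have -> : (\big[*%g/1]_(b.+1 <= a < n.+1 | P (inord a) || (inord a == b)) g (inord a)
    = \big[*%g/1]_(b.+1 <= a < n.+1 | P (inord a)) g (inord a))%g.
  rewrite [LHS]big_nat_cond [RHS]big_nat_cond; apply: eq_bigl => a.
  by have [/above[-> _]|] := boolP (b < a < n.+1)%N; rewrite //= orbF.
have -> : (\big[*%g/1]_(0 <= a < b | P (inord a) || (inord a == b)) g (inord a)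
    = \big[*%g/1]_(0 <= a < b | P (inord a)) g (inord a))%g.
  rewrite [LHS]big_nat_cond [RHS]big_nat_cond; apply: eq_bigl => a.
  by have [/below[-> _]|] := boolP (a < b)%N; rewrite //= orbF.
by rewrite !mulgA mulgK.
Qed.

Lemma hperm1 n (p : 'I_n -> form) : hperm 1%g p =1 p.
Proof.
move=> j; rewrite /hperm /crossing perm1 big1 ?hact1// => a.
by rewrite invg1 perm1 => /andP[ja aj]; have := ltn_trans ja aj; rewrite ltnn.
Qed.

(** Induction on the word: a new first letter i adds one crossing, of the strands i and i+1. They
    have not crossed before, because the word is reduced. *)
Lemma foldr_hbraid n (p : 'I_n.+1 -> form) (w : seq 'I_n) : reduced w ->
  foldr (fun (i : 'I_n) l => hbraid i l) [seq p j | j <- enum 'I_n.+1] w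
  = [seq hperm (perm_word w) p j | j <- enum 'I_n.+1].
Proof.
elim: w => [|i w IH] /=.
  by rewrite /perm_word big_nil => _; apply/eq_map => j; rewrite hperm1.
move=> /reduced_cons[/IH -> {IH}]; rewrite perm_word_cons.
set s := perm_word w; set t := simple_transp i.
have li : (i < n.+1)%N by rewrite ltnW// ltnS.
have li1 : (i.+1 < n.+1)%N by rewrite ltnS.
set i0 : 'I_n.+1 := inord i; set i1 : 'I_n.+1 := inord i.+1 => asc.
have i0E : i0 = i :> nat by rewrite inordK.
have i1E : i1 = i.+1 :> nat by rewrite inordK.
have tV : (t^-1)%g = t by rewrite /t /simple_transp tpermV.
have tsV a : ((t * s)^-1)%g a = t ((s^-1)%g a) by rewrite invMg permM tV.
have ti0 : t i0 = i1 by rewrite /t /simple_transp tpermL.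
have ti1 : t i1 = i0 by rewrite /t /simple_transp tpermR.
have ni0 (a : 'I_n.+1) : (s i1 < a)%N -> ((s^-1)%g a : nat) <> i.
  move=> sa sai; have aE : a = s i0.
    by rewrite -(permKV s a); congr (s _); apply: val_inj; rewrite /= sai i0E.
  by move: sa; rewrite aE ltnNge (ltnW asc).
apply: (@eq_from_nth _ (p i0)) => [|j]; first by rewrite size_hbraid !size_map.
rewrite size_hbraid size_map size_enum_ord => jn.
have nthE (f : 'I_n.+1 -> form) (m : nat) : (m < n.+1)%N ->
    nth (p i0) [seq f j | j <- enum 'I_n.+1] m = f (inord m).
  move=> mn; rewrite (nth_map ord0) ?size_enum_ord//; congr f.
  by apply: val_inj; rewrite /= nth_enum_ord// inordK.
rewrite nth_hbraid; last by rewrite size_map size_enum_ord.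
rewrite !nthE// -/i0 -/i1 /hperm.
(* The strand arriving at i passes one of smaller index, so it gains no twist. *)
have [->|ji] := eqVneq j i.
  rewrite -/i0 permM ti0; congr hact; apply: eq_bigl => a.
  rewrite tsV permM ti0; case: (ltnP (s i1) a) => //= sa; have := ni0 _ sa.
  rewrite simple_transpE i0E i1E.
  by case: eqP => // ? _; case: eqP; lia.
(* The strand arriving at i+1 is passed by the strand of larger index [s i1], whose twisted degree
   enters its crossing product. *)
have [->|ji1] := eqVneq j i.+1.
  rewrite -/i1 permM ti1 -hactM; congr hact.
  have -> : hdeg (hact (p (s i1)) (crossing s (fun a => hdeg (p a)) i1))
     = ((crossing s (fun a => hdeg (p a)) i1)^-1 * hdeg (p (s i1))
        * crossing s (fun a => hdeg (p a)) i1)%g by [].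
  (* This is the factor u of [prodg_insert]: the part of the crossing product at [i0] with indices
     above [s i1]. *)
  have -> : crossing s (fun a => hdeg (p a)) i1 =
     (\big[*%g/1]_(a < n.+1 | ((s i0 < a)%N && ((s^-1)%g a < i0)%N) && (s i1 < a)%N)
       hdeg (p a))%g.
    apply: eq_bigl => a; rewrite [RHS]andbC; case: (ltnP (s i1) a) => //= sa.
    rewrite (ltn_trans asc sa) /=; have := ni0 _ sa; rewrite i0E i1E; lia.
  rewrite /crossing prodg_insert; last by rewrite permK i0E i1E; lia.
  apply: eq_bigl => a; rewrite tsV permM ti1 simple_transpE i0E i1E.
  have -> : (a == s i1) = ((s^-1)%g a == i.+1 :> nat).
    by rewrite -i1E val_eqE -(inj_eq (@perm_inj _ s) _ i1) permKV.
  have [sai|sai] := ltnP (s i0) a; rewrite /=.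
    move: (nat_of_ord ((s^-1)%g a)) => y.
    by case: (y =P i :> nat) => ?; case: (y =P i.+1) => ?; lia.
  apply/negbTE; apply: contraTneq sai => sai.
  have -> : a = s i1.
    by rewrite -(permKV s a); congr (s _); apply: val_inj; rewrite /= sai i1E.
  by rewrite -ltnNge.
(* Elsewhere nothing changes, since i and i+1 lie on the same side of j. *)
have jE : (inord j : 'I_n.+1) = j :> nat by rewrite inordK.
have tj : t (inord j) = inord j.
  by apply: val_inj; rewrite /= simple_transpE jE (negbTE ji) (negbTE ji1).
rewrite permM tj; congr hact; apply: eq_bigl => a.
rewrite tsV permM tj simple_transpE jE; congr (_ && _).
by case: eqP => ?; [lia|case: eqP => ?; lia].
Qed.

(** A closed formula for the pairing with a symmetrized tensor, stated for all [n] so that a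
    recursion can end in degree 0. *)
Definition sym_pairing n (p : 'I_n -> form) (v : 'I_n -> M) : k :=
  \sum_(s : 'S_n) \prod_(j < n) hperm s p j (v j).

Lemma pairing_qsymE n l x : pairing l (qsym n x) =
  \sum_(s : 'S_n.+1) pairing (foldr (fun (i : 'I_n) l => hbraid i l) l (reduced_word s)) x.
Proof.
have pD : {morph pairing l : x y / x + y} by exact: linearD.
rewrite (big_morph _ pD (linear0 (pairing l))); apply: eq_bigr => s _.
exact: pairing_braids.
Qed.

Lemma pairing_word_map (I : Type) (e : seq I) (p : I -> form) (v : I -> M) :
  pairing_word (map p e) (map v e) = \prod_(i <- e) p i (v i).
Proof. by elim: e => [|i e IH] /=; rewrite ?big_nil// big_cons IH. Qed.

Lemma pairing_qsym n (p : 'I_n.+1 -> form) (v : 'I_n.+1 -> M) :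
  pairing [seq p j | j <- enum 'I_n.+1] (qsym n (tprod [seq v j | j <- enum 'I_n.+1]))
  = sym_pairing p v.
Proof.
rewrite pairing_qsymE; apply: eq_bigr => s _.
have [ws rw] : perm_word (reduced_word s) = s /\ reduced (reduced_word s).
  by rewrite /reduced_word; case: cid.
by rewrite foldr_hbraid// ws pairing_prod pairing_word_map big_enum.
Qed.

(** The letters left after a derivation of degree g consumes letter j; those to its right, which
    have j <= i after renumbering, are acted on by g. *)
Definition drop_act n (j : 'I_n.+1) (g : G) (v : 'I_n.+1 -> M) (i : 'I_n) : M :=
  if (j <= i)%N then yd_act M g (v (lift j i)) else v (lift j i).

Lemma big_lift_perm (V : zmodType) n (j : 'I_n.+1) (F : 'S_n.+1 -> V) :
  \sum_(s : 'S_n.+1 | s j == ord_max) F s = \sum_(s : 'S_n) F (lift_perm j ord_max s).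
Proof.
rewrite (reindex (lift_perm j ord_max)) /=; last first.
  (* The inverse of [lift_perm] deletes j and its image. The default of [odflt] never occurs, as s
     is injective. *)
  pose f (s : 'S_n.+1) i := odflt i (unlift (s j) (s (lift j i))).
  have fK (s : 'S_n.+1) i : lift (s j) (f s i) = s (lift j i).
    by rewrite /f; have:= neq_lift j i; rewrite -(inj_eq (@perm_inj _ s)) => /unlift_some[] ? ? ->.
  have f_inj (s : 'S_n.+1) : injective (f s).
    by move=> i i' e; apply: (@lift_inj _ j); apply: (@perm_inj _ s); rewrite -!fK e.
  exists (fun s => perm (f_inj s)) => s.
    move=> _; apply/permP => i; rewrite permE; apply: (@lift_inj _ (lift_perm j ord_max s j)).
    by rewrite fK !lift_perm_id lift_perm_lift.
  rewrite inE => /eqP sj; apply/permP => i; case: (unliftP j i) => [i'|] ->.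
    by rewrite lift_perm_lift permE -sj fK.
  by rewrite lift_perm_id.
by apply: eq_bigl => s; rewrite lift_perm_id eqxx.
Qed.

(** The index [ord_max] exceeds all others, so it contributes the last factor, exactly to the
    strands right of j. *)
Lemma crossing_lift n (s : 'S_n) (g : 'I_n.+1 -> G) (j : 'I_n.+1) (i : 'I_n) :
  crossing (lift_perm j ord_max s) g (lift j i)
  = (crossing s (fun a => g (lift ord_max a)) i * (if (j <= i)%N then g ord_max else 1))%g.
Proof.
have lt (a b : 'I_n) : (lift j a < lift j b)%N = (a < b)%N.
  by rewrite /= /bump; lia.
rewrite /crossing lift_permV lift_perm_lift big_mkcond big_ord_recr.
congr (_ * _)%g.
  rewrite [RHS]big_mkcond; apply: eq_bigr => a _.
  have -> : widen_ord (leqnSn n) a = lift ord_max a.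
    by apply: val_inj; rewrite /= /bump leqNgt ltn_ord.
  by rewrite lift_perm_lift lt !lift_max.
rewrite lift_perm_id lift_max ltn_ord /=.
by have -> : (j < bump j i)%N = (j <= i)%N by rewrite /bump; lia.
Qed.

(** Permutations are sorted by the position j of the largest index. That strand is not twisted
    itself and twists all strands to its right, as a skew derivation does. *)
Lemma sym_pairing_recr n (p : 'I_n.+1 -> form) (v : 'I_n.+1 -> M) :
  sym_pairing p v = \sum_j p ord_max (v j) *
    sym_pairing (fun i => p (lift ord_max i)) (drop_act j (hdeg (p ord_max)) v).
Proof.
rewrite /sym_pairing (partition_big (fun s : 'S_n.+1 => (s^-1)%g ord_max) xpredT)//=.
apply: eq_bigr => j _; rewrite mulr_sumr.
under eq_bigl => s do rewrite (canF_eq (permKV s)) eq_sym.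
rewrite big_lift_perm; apply: eq_bigr => s _.
rewrite (bigD1_ord j)//=; congr (_ * _).
  rewrite /hperm lift_perm_id /crossing lift_perm_id big1 /= ?yd_act1// => a.
  by rewrite ltnNge -ltnS ltn_ord.
apply: eq_bigr => i _; rewrite /hperm lift_perm_lift crossing_lift /drop_act.
by case: ifP => _; rewrite /= ?mulg1// yd_actM.
Qed.

Lemma tprod_enum n (v : 'I_n -> M) :
  tprod [seq v j | j <- enum 'I_n] = \prod_(i < n) tvar (v i).
Proof. by rewrite /tprod big_map enumT [index_enum _]unlock. Qed.

Lemma tder_tprod p n (v : 'I_n.+1 -> M) :
  tder p (\prod_(i < n.+1) tvar (v i)) =
  \sum_j p (v j) *: \prod_(i < n) tvar (drop_act j (hdeg p) v i).
Proof.
elim: n v => [|n IH] v.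
  by rewrite !big_ord1 big_ord0 tder_tvar.
rewrite big_ord_recl tder_tvarM IH [RHS]big_ord_recl addrC; congr (_ + _).
  by rewrite -tprod_enum tens_act_prod -map_comp tprod_enum.
rewrite mulr_sumr; apply: eq_bigr => j _.
rewrite [in RHS]big_ord_recl -scalerAr; congr (_ *: (_ * _)).
  by rewrite /drop_act /=; congr (tvar (v _)); apply: val_inj.
apply: eq_bigr => i _; congr tvar; rewrite /drop_act.
have -> : lift (lift ord0 j) (lift ord0 i) = lift ord0 (lift j i).
  by apply: val_inj; rewrite /= /bump; lia.
by [].
Qed.

Lemma iter_der_sum l I (r : seq I) (c : I -> k) (F : I -> tens M) :
  iter_der l (\sum_(i <- r) c i *: F i) = \sum_(i <- r) c i * iter_der l (F i).
Proof.
rewrite (big_morph _ (iter_derD l) (linear0 (iter_der l))).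
by apply: eq_bigr => i _; exact: linearZ.
Qed.

(** Both sides obey the same recursion on the last form. *)
Lemma iter_der_sym n (p : 'I_n -> form) (v : 'I_n -> M) :
  iter_der [seq p j | j <- enum 'I_n] (tprod [seq v j | j <- enum 'I_n])
  = sym_pairing p v.
Proof.
rewrite tprod_enum; elim: n p v => [|n IH] p v.
  rewrite big_ord0 /sym_pairing enum_ord0 /iter_der/= counit1.
  rewrite (big_pred1 1%g) ?big_ord0// => s.
  by rewrite /=; apply/esym/eqP/permP => -[].
rewrite sym_pairing_recr enum_ordSr map_rcons iter_der_rcons tder_tprod iter_der_sum.
apply: eq_bigr => j _; rewrite -IH -map_comp; congr (_ * iter_der _ _).
apply: eq_map => a /=; congr p; apply: val_inj.
by rewrite /= /bump leqNgt ltn_ord.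
Qed.

(** Each derivation lowers the degree by one, and the counit sees degree 0 only. *)
Lemma iter_der_size l w : size l != size w -> iter_der l (tprod w) = 0.
Proof.
elim/last_ind: l w => [|l p IH] w.
  by rewrite /iter_der/= counit_prod; case: w.
rewrite size_rcons iter_der_rcons; case: w => [_|m w].
  by rewrite tprod_nil tder1; exact: linear0.
rewrite eqSS => lw; pose t : (size w).+1.-tuple M := in_tuple (m :: w).
have -> : m :: w = t by [].
rewrite -(map_tnth_enum t) tprod_enum tder_tprod iter_der_sum big1// => j _.
by rewrite -tprod_enum IH ?mulr0// size_map size_enum_ord.
Qed.

Lemma iter_der_qsym n x l : tens_deg n.+1 x -> size l = n.+1 ->
  iter_der l x = pairing l (qsym n x).
Proof.
move=> [r ->] ls; rewrite pairing_qsymE.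
under [RHS]eq_bigr do rewrite linear_sum.
rewrite exchange_big iter_der_sum; apply: eq_bigr => -[a t] _ /=.
under [RHS]eq_bigr do rewrite linearZ /=.
rewrite -scaler_sumr; congr (_ * _); rewrite -pairing_qsymE.
pose u := tcast ls (in_tuple l).
have <- : tval u = l by rewrite val_tcast.
by rewrite -(map_tnth_enum u) -(map_tnth_enum t) iter_der_sym pairing_qsym.
Qed.

(** As the radical is an ideal, the kernels of the symmetrizers suffice. Lists of the wrong length
    vanish by degree, and the others factor through the symmetrizer. *)
Lemma nichols_ideal_radical (x : tens M) : nichols_ideal x -> der_radical x.
Proof.
apply; first exact: der_radical_ideal.
move=> _ [N [f [fP ->]]] l.
rewrite (big_morph _ (iter_derD l) (linear0 (iter_der l))) big_nat big1// => n /andP[n1 _].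
have [fd fq] := fP n n1.
have [ls|ls] := eqVneq (size l) n.+1; first by rewrite (iter_der_qsym fd ls) fq linear0.
case: fd => r ->; rewrite iter_der_sum big1// => -[a t] _ /=.
by rewrite iter_der_size ?mulr0// size_tuple.
Qed.

End DualBraiding.

(** * Linear independence in the Nichols algebra *)

Lemma card_finset_bigcup (I T : finType) (F : I -> {set T}) (C : nat) :
  (forall i, #|F i| <= C)%N -> (#|\bigcup_i F i| <= C * #|I|)%N.
Proof.
move=> FC; apply: (@leq_trans (\sum_i #|F i|)); last first.
  by rewrite mulnC -sum_nat_const leq_sum.
elim/big_rec2: _ => [|i n A _ IH]; first by rewrite cards0.
by rewrite (leq_trans (leq_card_setU _ _))// leq_add2l.
Qed.

(** Choose rows forming a basis of the row space. By its diagonal entry no column is zero, so some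
    chosen row is nonzero there, and each chosen row serves at most C columns. *)
Lemma rank_sparse (k : fieldType) (N C : nat) (A : 'M[k]_N) :
  (forall i, A i i != 0) -> (forall i, #|[set j | A i j != 0%R]| <= C)%N ->
  (N <= C * \rank A)%N.
Proof.
move=> Ad AC; pose f := maxrankfun A.
have /card_finset_bigcup : forall i, (#|[set j | A (f i) j != 0%R]| <= C)%N.
  by move=> i; exact: AC.
rewrite card_ord; apply: leq_trans; rewrite -{1}[N]card_ord -cardsT.
apply: subset_leq_card; apply/fintype.subsetP => j _; apply/finset.bigcupP.
have /submxP[B AB] : (A <= rowsub f A)%MS by rewrite eq_maxrowsub.
have : A j j != 0 by [].
rewrite {1}AB mxE => /eqP sum0.
have [i _ /eqP ij] : exists2 i, true & B j i * rowsub f A i j <> 0.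
  apply: contrapT => nex; apply: sum0; apply: big1 => i _.
  by apply: contrapT => ij; apply: nex; exists i.
exists i => //; rewrite inE; apply: contra ij => /eqP.
by rewrite [rowsub _ _ _ _]mxE => ->; rewrite mulr0.
Qed.

Section Independence.
Context (k : fieldType) (G : groupType) (M : ydModule k G).
Local Notation form := (homog_form M).

(** Each derivation must have the degree of a letter still present, which leaves n choices, then n -
    1, and so on. *)
Lemma iter_der_support n (v : 'I_n -> M) : (forall i, exists h, yd_gr h (v i)) ->
  exists L : seq (seq G), (size L <= n`!)%N /\ forall l : seq form,
    iter_der l (\prod_(i < n) tvar (v i)) != 0 -> [seq hdeg p | p <- l] \in L.
Proof.
elim: n v => [|n IH] v vh.
  exists [:: [::]]; split=> // l; rewrite big_ord0.
  elim/last_ind: l => [|l p _]; first by rewrite inE.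
  rewrite iter_der_rcons tder1.
  by have -> : iter_der l 0 = 0 by [exact: linear0]; rewrite eqxx.
have [h hP] := choice vh.
have /choice[L LP] : forall j : 'I_n.+1, exists L : seq (seq G),
    (size L <= n`!)%N /\ forall l : seq form,
    iter_der l (\prod_(i < n) tvar (drop_act j (h j) v i)) != 0 ->
    [seq hdeg p | p <- l] \in L.
  move=> j; apply: IH => i; rewrite /drop_act; case: ifP => _.
    exists (h j * h (lift j i) * (h j)^-1)%g; rewrite -yd_gr_act.
    by exists (v (lift j i)).
  by exists (h (lift j i)).
(* [h j] goes last because the last form acts first. *)
exists (flatten [seq [seq rcons s (h j) | s <- L j] | j <- enum 'I_n.+1]); split.
  rewrite size_flatten sumnE 2!big_map big_enum /=.
  apply: (@leq_trans (\sum_(i < n.+1) n`!)).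
    by apply: leq_sum => i _; rewrite size_map; exact: (LP i).1.
  by rewrite sum_nat_const card_ord factS.
move=> l; elim/last_ind: l => [|l p _].
  rewrite /iter_der /= big_ord_recl counitM.
  have -> : counit (tvar (v ord0)) = 0.
    by rewrite -[tvar _]mulr1 -(tprod_nil M) -tprod_cons counit_prod.
  by rewrite mul0r eqxx.
rewrite iter_der_rcons tder_tprod iter_der_sum => /eqP sum0.
have [j _ /eqP] : exists2 j, true & p (v j) *
    iter_der l (\prod_(i < n) tvar (drop_act j (hdeg p) v i)) <> 0.
  apply: contrapT => nex; apply: sum0; apply: big1 => j _.
  by apply: contrapT => pj; apply: nex; exists j.
rewrite mulf_eq0 negb_or => /andP[pj lj].
have hj : h j = hdeg p.
  by apply/eqP; apply: contraNT pj => hp; rewrite (hf_neq (hP j) hp).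
apply/flattenP; exists [seq rcons s (h j) | s <- L j].
  by apply/mapP; exists j; rewrite ?mem_enum.
by rewrite map_rcons -hj; apply/map_f/(LP j).2; rewrite hj.
Qed.

Section Dual.
Context (T : eqType) (v : T -> M) (p : T -> form).
Hypothesis vP : forall t, yd_gr (hdeg (p t)) (v t).
Hypothesis pv : forall t, p t (v t) = 1.
Hypothesis p_inj : injective (fun t => hdeg (p t)).

Lemma tder_notin t ts : t \notin ts -> tder (p t) (tprod (map v ts)) = 0.
Proof.
elim: ts => [|t' ts IH]; first by rewrite tprod_nil tder1.
rewrite inE negb_or => /andP[tt' tts] /=.
rewrite tprod_cons tder_tvarM IH// mulr0 add0r (hf_neq (vP t')) ?scale0r//.
by rewrite (inj_eq p_inj) eq_sym.
Qed.

(** Letters are removed from the right end, so no group element acts on those that remain; distinct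
    degrees leave one term. *)
Lemma iter_der_diag ts : uniq ts -> iter_der (map p ts) (tprod (map v ts)) = 1.
Proof.
elim/last_ind: ts => [_|ts t IH].
  by rewrite /iter_der /= tprod_nil counit1.
rewrite rcons_uniq => /andP[tts uts]; rewrite !map_rcons iter_der_rcons.
rewrite -cats1 tprod_cat tprod_cons tprod_nil mulr1 tderM tder_notin// mul0r addr0.
by rewrite tder_tvar pv scale1r mulr1 IH.
Qed.

(** The derivations vanish on the Nichols ideal, so independent rows of their matrix [A] give
    independent elements. Sparsity of [A] bounds its rank from below. *)
Lemma bosonization_indep (I : finType) (d : nat) (c : I -> d.-tuple T) :
  injective c -> (forall i, uniq (c i)) ->
  exists (m : nat) (f : 'I_m -> I),
    lin_indep (fun i => smash_elt (nichols_action M)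
                 (npi (tprod (map v (c (f i))))) 1%g : bosonization M)
    /\ (#|I| <= d`! * m)%N.
Proof.
move=> c_inj c_uniq; pose x i : tens M := tprod (map v (c i)).
pose A : 'M[k]_#|I| := \matrix_(i, j) iter_der (map p (c (enum_val j))) (x (enum_val i)).
have /rank_sparse rkA : forall i, A i i != 0.
  by move=> i; rewrite mxE iter_der_diag// oner_eq0.
exists (\rank A), (fun i => enum_val (maxrankfun A i)); split; last first.
  apply: rkA => i; pose w := c (enum_val i).
  have [|L [Ls LP]] := @iter_der_support d (fun j => v (tnth w j)).
    by move=> j; exists (hdeg (p (tnth w j))).
  (* A column is determined by the degrees of its forms, so the list [L] bounds the number of
     nonzero entries. *)
  rewrite cardE; pose g (j : 'I_#|I|) := map (@hdeg k G M) (map p (c (enum_val j))).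
  have g_inj : injective g.
    move=> j j'; rewrite /g -!map_comp => /(inj_map p_inj)/val_inj/c_inj.
    exact: enum_val_inj.
  rewrite -(size_map g); apply: leq_trans Ls; apply: uniq_leq_size.
    by rewrite map_inj_uniq// enum_uniq.
  move=> y /mapP[j]; rewrite mem_enum inE => Aij ->; apply: LP.
  rewrite mxE /x -[val (c (enum_val i))](map_tnth_enum w) -map_comp tprod_enum in Aij.
  exact: Aij.
move=> a asum; pose F := maxrankfun A.
(* The coefficient at the unit of G turns the relation into one in B(M). *)
have /npiP : npi (\sum_i a i *: x (enum_val (F i))) = npi 0.
  have npi0 : @npi k G M 0 = 0 by [].
  have ev1 : {morph (fun y : bosonization M => y 1%g) : y z / y + z} by [].
  rewrite npi0 (big_morph _ (@npiD k G M) npi0).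
  have /(congr1 (fun y : bosonization M => y 1%g)) := asum.
  rewrite (big_morph _ ev1 erefl) => a1; rewrite -[RHS]a1; apply: eq_bigr => i _.
  by rewrite npiZ /= eqxx.
rewrite subr0 => /nichols_ideal_radical xK.
have rA0 : (\row_i a i) *m rowsub F A = 0.
  apply/rowP => j; rewrite !mxE.
  have e := xK (map p (c (enum_val j))); rewrite iter_der_sum in e.
  by rewrite -[RHS]e; apply: eq_bigr => i _; rewrite !mxE.
have /rowP a0 : \row_i a i = 0.
  by apply/eqP; rewrite -(mulmx_free_eq0 _ (maxrowsub_free A)) rA0.
by move=> i; have := a0 i; rewrite !mxE.
Qed.

End Dual.
End Independence.

(** * Growth *)

Section Growth.
Context (k : fieldType) (A : algType k).
Implicit Types (s : seq A) (a b : A).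

Lemma products_mul s i j a b :
  a \in products s i -> b \in products s j -> a * b \in products s (i + j).
Proof.
elim: i a => [|i IH] a /=; first by rewrite inE => /eqP ->; rewrite mul1r.
move=> /allpairsP[[x y] /= [xs ys ->]] bs; rewrite -mulrA.
by apply/allpairsP; exists (x, y * b); split=> //; exact: IH.
Qed.

Lemma mem_products1 s a : a \in s -> a \in products s 1.
Proof. by move=> sa; apply/allpairsP; exists (a, 1); rewrite mulr1 /= inE. Qed.

Lemma mem_products_upto s i n a : (i <= n)%N ->
  a \in products s i -> a \in products_upto s n.
Proof.
move=> ltin ai; apply/flattenP; exists (products s i) => //.
by apply: map_f; rewrite mem_iota.
Qed.

Lemma dim_span_ge s m (v : 'I_m -> A) :
  lin_indep v -> (forall i, v i \in s) -> (m <= Defs.dim_span s)%N.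
Proof.
move=> vl vs; have v_inj : injective v.
  move=> i j vij; apply/eqP/negPn/negP => ij.
  pose c l : k := (l == i)%:R - (l == j)%:R.
  have /(_ i)/eqP : forall l, c l = 0.
    apply: vl; rewrite /c.
    under eq_bigr do rewrite scalerBl !scaler_nat.
    rewrite big_split /= sumrN.
    under [X in X - _]eq_bigr do rewrite mulrb.
    under [X in _ - X]eq_bigr do rewrite mulrb.
    by rewrite -!big_mkcond !big_pred1_eq vij subrr.
  by rewrite /c eqxx (negbTE ij) subr0 oner_eq0.
(* The maximum defining [dim_span] ranges only over values up to [size s]. *)
have ms : (m < (size s).+1)%N.
  rewrite ltnS -[m in (m <= _)%N]size_enum_ord -(size_map v).
  apply: uniq_leq_size; first by rewrite map_inj_uniq ?enum_uniq.
  by move=> _ /mapP[i _ ->].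
apply: (@leq_bigmax_cond _ _ _ (Ordinal ms)) => /=.
apply/asboolP; exists v; split=> // i.
have si : (index (v i) s < size s)%N by rewrite index_mem.
exists (fun j => (j == Ordinal si)%:R).
under eq_bigr do rewrite scaler_nat mulrb.
by rewrite -big_mkcond big_pred1_eq /= nth_index.
Qed.

(** For fixed d, about r^d independent products occur in length O(r). Taking d = 2 e and r large
    gives dimension at least n^e. *)
Lemma GKdim_pinfty (R : realType) s :
  (forall d r n, (d * (2 * (d * r) + 1) <= n)%N ->
    (r ^ d <= d`! * Defs.dim_span (products_upto s n))%N) ->
  GKdim R A = +oo%E.
Proof.
move=> growth; apply/eqyP => x _; pose e := (Num.truncn x).+1.
apply: le_trans (_ : (e%:R)%:E <= _)%E; first by rewrite lee_fin ltW ?truncnS_gt.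
apply: le_trans (ereal_sup_ubound _); last by exists s.
(* The upper limit is an infimum over index sets V containing a tail, so one good n in each V
   suffices. *)
apply: le_ereal_inf_tmp => _ [V [N _ NV] <-].
(* C r bounds d (2 d r + 1). With r >= C d!, the spare factor r^e absorbs C^e d!; r >= N puts n in
   V, and the added 2 makes ln n positive. *)
pose d := (2 * e)%N; pose C := (3 * d ^ 2)%N.
pose r := (N + C * d`! + 2)%N; pose n := (C * r)%N.
have d0 : (0 < d)%N by rewrite muln_gt0.
have C0 : (0 < C)%N by rewrite muln_gt0 expn_gt0 d0.
have rn : (r <= n)%N by rewrite leq_pmull.
have n1 : (1 < n)%N by rewrite (leq_trans _ rn)// /r; lia.
have Vn : V n by apply: NV; rewrite /= (leq_trans _ rn)// /r; lia.
apply: le_trans (ereal_sup_ubound _); last by exists n.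
have dn : (n ^ e <= Defs.dim_span (products_upto s n))%N.
  have : (d * (2 * (d * r) + 1) <= n)%N by rewrite /n /C; nia.
  move=> /growth; rewrite -(@leq_pmul2l d`! (n ^ e)) ?fact_gt0//; apply: leq_trans.
  rewrite /n expnMn mulnA {2}/d mul2n -addnn expnD leq_mul2r; apply/orP; right.
  apply: (@leq_trans ((C * d`!) ^ e)); last by rewrite leq_exp2r// /r; lia.
  rewrite expnMn mulnC leq_mul2l; apply/orP; right.
  by rewrite -{1}[d`!]expn1 leq_pexp2l ?fact_gt0.
have n0 : (0 < n ^ e)%N by rewrite expn_gt0 (ltnW n1).
have lnn : (0 : R) < ln n%:R by rewrite ln_gt0// ltr1n.
rewrite lee_fin ler_pdivlMr// mulr_natl -lnXn ?ltr0n ?(ltnW n1)//.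
by rewrite -natrX ler_ln ?posrE ?ltr0n ?ler_nat// (leq_trans n0).
Qed.

End Growth.

(** * Conjugates reached by words of bounded length *)

Section Schreier.
Context (G : groupType) (S : seq G).
Hypothesis S_inv : forall g, g \in S -> (g^-1)%g \in S.
Hypothesis S_gen : forall H : set G,
    H 1%g -> (forall g h, H g -> H h -> H (g * h)%g) ->
    (forall g, H g -> H g^-1%g) -> (forall g, g \in S -> H g) ->
    forall g, H g.

Definition word_length_le (n : nat) (g : G) : Prop :=
  exists w : seq G, [/\ all (mem S) w, (size w <= n)%N & (g = \big[*%g/1]_(h <- w) h)%g].

(** A finite set of conjugates cannot be stable under all generators, so one more letter always
    reaches a new conjugate. *)
Lemma conj_orbit_grows (x : G) : infinite_set (conj_class x) -> forall n,
  exists gs : seq G, [/\ size gs = n.+1, uniq [seq (g * x * g^-1)%g | g <- gs]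
    & forall g, g \in gs -> word_length_le n g].
Proof.
move=> infx; elim=> [|n [gs [gs_size gs_uniq gs_len]]].
  exists [:: 1%g]; split=> // g; rewrite inE => /eqP ->.
  by exists [::]; rewrite big_nil.
pose X := [seq (g * x * g^-1)%g | g <- gs].
have [[h [g [hS ggs hgX]]]|closed] := pselect (exists h g,
    [/\ h \in S, g \in gs & (h * g * x * (h * g)^-1)%g \notin X]).
  exists ((h * g)%g :: gs); split; first by rewrite /= gs_size.
    by rewrite /= gs_uniq andbT.
  move=> g'; rewrite inE => /orP[/eqP ->|/gs_len[w [wS wn wE]]]; last first.
    by exists w; rewrite (leqW wn).
  have [w [wS wn ->]] := gs_len g ggs; exists (h :: w).
  by rewrite /= hS wS ltnS wn big_cons.
(* Otherwise X is a finite set stable under conjugation by the generators. *)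
have stab h y : h \in S -> y \in X -> (h * y * h^-1)%g \in X.
  move=> hS /mapP[g ggs ->]; apply/negPn/negP => hgX; apply: closed.
  by exists h, g; split=> //; rewrite invgM !mulgA in hgX *.
exfalso.
have Xinf := infx; apply: Xinf.
have fX : finite_set [set` X] by exact: finite_seq.
(* Stability under both g and g^-1 is recorded so that [P] is closed under inverses. *)
pose P (g : G) := forall y, (y \in X -> (g * y * g^-1)%g \in X)
                         /\ (y \in X -> (g^-1 * y * g)%g \in X).
have PG : forall g, P g.
  apply: S_gen.
  - by move=> y; rewrite invg1 !mul1g !mulg1.
  - move=> g h Pg Ph y; split=> yX; rewrite invgM !mulgA.
      by have := (Pg _).1 ((Ph _).1 yX); rewrite !mulgA.
    by have := (Ph _).2 ((Pg _).2 yX); rewrite !mulgA.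
  - by move=> g Pg y; rewrite invgK; have [] := Pg y.
  - move=> g gS y; split=> yX; first exact: stab.
    by have := stab _ _ (S_inv gS) yX; rewrite invgK.
have [g0 g0X] : exists g0, g0 \in gs.
  by case: gs gs_size {gs_uniq gs_len X closed stab fX P PG} => // g gs _; exists g; rewrite inE eqxx.
have X0 : (g0 * x * g0^-1)%g \in X by exact: map_f.
apply: sub_finite_set fX => _ [g _ <-] /=.
have := (PG (g * g0^-1)%g _).1 X0.
by rewrite invgM invgK !mulgA !mulgKV.
Qed.

End Schreier.

(** * Words in the letters g m as products of generators *)

Section BosonizationProducts.
Context (k : fieldType) (G : groupType) (M : ydModule k G).
Local Notation B := (bosonization M).
Context (S : seq G) (m : M).
Hypothesis S_inv : forall g, g \in S -> (g^-1)%g \in S.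

Definition boson_grp (g : G) : B := smash_elt (nichols_action M) 1 g.
Definition boson_tens (x : tens M) : B := smash_elt (nichols_action M) (npi x) 1%g.

Definition boson_gens : seq B := rcons [seq boson_grp g | g <- S] (boson_tens (tvar m)).

Lemma boson_grpM g h : boson_grp g * boson_grp h = boson_grp (g * h)%g.
Proof. by rewrite /boson_grp smash_eltM aact_one mulr1. Qed.

Lemma boson_tensM x y : boson_tens x * boson_tens y = boson_tens (x * y).
Proof. by rewrite /boson_tens smash_eltM aact_id mulg1 npiM. Qed.

Lemma boson_tens1 : boson_tens 1 = 1.
Proof. by rewrite /boson_tens npi1. Qed.

Lemma boson_conj g x :
  boson_grp g * boson_tens x * boson_grp g^-1 = boson_tens (tens_act g x).
Proof.
rewrite /boson_grp /boson_tens !smash_eltM !aact_one mulr1 mul1r mulg1 mulgV.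
by congr smash_elt; exact: nichols_actE.
Qed.

Lemma boson_grp_word (w : seq G) : all (mem S) w ->
  boson_grp (\big[*%g/1]_(h <- w) h)%g \in products boson_gens (size w).
Proof.
elim: w => [_|h w IH /= /andP[hS wS]]; first by rewrite big_nil /= inE.
rewrite big_cons -boson_grpM.
apply: (@products_mul _ _ _ 1); last exact: IH.
by apply: mem_products1; rewrite mem_rcons inE map_f ?orbT.
Qed.

(** The letter g m is the conjugate of m by g: a word for g, then m, then the reversed word of
    inverses. *)
Lemma boson_letter n g : word_length_le S n g ->
  exists2 j, (j <= 2 * n + 1)%N &
    boson_tens (tvar (yd_act M g m)) \in products boson_gens j.
Proof.
move=> [w [wS wn gE]]; pose w' := rev [seq (h^-1)%g | h <- w].
have w'S : all (mem S) w'.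
  rewrite all_rev all_map; apply/allP => h hw /=; apply: S_inv.
  exact: (allP wS).
have w'E : (\big[*%g/1]_(h <- w') h = g^-1)%g.
  by rewrite /w' -map_rev big_map prodgV revK gE.
exists (size w + 1 + size w')%N; first by
  rewrite size_rev size_map addnAC leq_add2r mul2n -addnn leq_add.
rewrite -tens_act_tvar -boson_conj -w'E gE.
apply: products_mul; last exact: boson_grp_word.
apply: products_mul; first exact: boson_grp_word.
by apply: mem_products1; rewrite mem_rcons inE eqxx.
Qed.

Lemma boson_word (T : Type) (u : T -> M) (n : nat) :
  (forall t, exists2 j, (j <= n)%N & boson_tens (tvar (u t)) \in products boson_gens j) ->
  forall ts : seq T, exists2 j, (j <= size ts * n)%N &
    boson_tens (tprod (map u ts)) \in products boson_gens j.
Proof.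
move=> un; elim=> [|t ts [j jn jP]].
  by exists 0%N; [rewrite leq0n | rewrite /= tprod_nil boson_tens1 mem_head].
have [i iN iP] := un t; exists (i + j)%N; first by rewrite mulSn leq_add.
by rewrite /= tprod_cons -boson_tensM; exact: products_mul.
Qed.

End BosonizationProducts.

Theorem theorem2p6 (R : realType) (k : closedFieldType)
  (char0 : [pchar k] =i pred0)
  (G : groupType) (fgG : finitely_generated G)
  (M : ydModule k G) (x : G)
  (suppM : yd_supp M = conj_class x)
  (infM : infinite_set (yd_supp M)) :
  GKdim R (bosonization M) = +oo%E.
Proof.
have [S0 S0gen] := fgG; pose S := S0 ++ [seq (g^-1)%g | g <- S0].
have S_inv g : g \in S -> (g^-1)%g \in S.
  rewrite !mem_cat => /orP[gS|/mapP[h hS ->]]; first by rewrite map_f ?orbT.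
  by rewrite invgK hS.
have S_gen (H : set G) : H 1%g -> (forall g h, H g -> H h -> H (g * h)%g) ->
    (forall g, H g -> H g^-1%g) -> (forall g, g \in S -> H g) -> forall g, H g.
  move=> H1 HM HV HS; apply: S0gen => // g gS; apply: HS.
  by rewrite mem_cat gS.
have [m xm m0] : yd_supp M x by rewrite suppM; exists 1%g => //; rewrite mul1g invg1 mulg1.
rewrite suppM in infM.
apply: (@GKdim_pinfty _ _ _ (boson_gens S m)) => d r n dn.
have [gs [gs_size gs_uniq gs_len]] := conj_orbit_grows S_inv S_gen infM (d * r).
(* Letters are indexed by block and place in the block; of the d r + 1 available conjugates, d r are
   used. *)
pose T : finType := ('I_d * 'I_r)%type.
have cardT : #|{: T}| = (d * r)%N by rewrite card_prod !card_ord.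
have rkT (t : T) : (enum_rank t < size gs)%N.
  by rewrite gs_size ltnW// ltnS -cardT ltn_ord.
pose g (t : T) := nth 1%g gs (enum_rank t).
pose v t : M := yd_act M (g t) m.
pose y t := (g t * x * (g t)^-1)%g.
have vy t : yd_gr (y t) (v t) by rewrite -yd_gr_act; exists m.
have v0 t : v t != 0.
  apply: contraNneq m0 => vt0.
  by rewrite -(yd_act1 m) -(mulVg (g t)) yd_actM -/(v t) vt0 linear0.
have /choice[p pP] : forall t, exists p : homog_form M, hdeg p = y t /\ p (v t) = 1.
  by move=> t; apply: hf_exists.
have vp t : yd_gr (hdeg (p t)) (v t) by rewrite (pP t).1.
have p_inj : injective (fun t => hdeg (p t)).
  move=> t t'; rewrite (pP t).1 (pP t').1 /y /g.
  rewrite -!(nth_map _ (1%g) (fun g => g * x * g^-1)%g)// => /eqP.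
  by rewrite nth_uniq ?size_map// => /eqP/val_inj/enum_rank_inj.
(* The q-th letter comes from block q, so the letters of a word are distinct and the word determines
   [I]. *)
pose c (I : {ffun 'I_d -> 'I_r}) : d.-tuple T := [tuple (q, I q) | q < d].
have c_inj : injective c.
  move=> I J /(congr1 (fun u => tnth u)) IJ; apply/ffunP => q.
  by have := congr1 (@^~ q) IJ; rewrite /= !tnth_mktuple => -[].
have c_uniq I : uniq (c I).
  by apply/tuple_uniqP => q q'; rewrite !tnth_mktuple => -[].
have [N [f [indep]]] := bosonization_indep vp (fun t => (pP t).2) p_inj c_inj c_uniq.
rewrite card_ffun !card_ord => rN; apply: (leq_trans rN).
rewrite leq_mul2l; apply/orP; right; apply: (dim_span_ge indep) => i.
have [|j jn jP] := @boson_word _ _ M S m T v (2 * (d * r) + 1) _ (c (f i)).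
  move=> t; apply: boson_letter => //; apply: gs_len; exact: mem_nth.
apply: mem_products_upto jP; apply: leq_trans dn.
by rewrite size_tuple in jn.
Qed.
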